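(* Let $n$ be an integer with $n\geq 6$, and let $l,r$ be nonzero complex numbers such that $r^{2k}\ne1$ for $1\le k\le n$ and $r^{2k}\ne-1$ for $1\le k\le n-1$ (so that the Hecke algebras $\mathcal H(D_n)$ and $\mathcal H_{F,r^2}(n)$ are semisimple). If there exists an irreducible $\frac{n(n-3)}2$-dimensional invariant subspace inside $V_n$, then $l=r^3$.
   Context: Put $m=\frac1r-r$ and $F=\mathbb Q(l,r)\subset\mathbb C$. $V_n$ is the $F$-vector space with basis $\{w_{ij},\widehat{w_{ij}}:1\le i<j\le n\}$. It carries endomorphisms $\nu_1,\dots,\nu_n$ defined as follows ($\overline{w_{s,t}}$ stands for either $w_{s,t}$ or $\widehat{w_{s,t}}$, same choice on both sides); they define a representation of the Cohen--Gijsbers--Wales algebra of type $D_n$. $\nu_1$: for $3\le i<j\le n$, $\nu_1(\widehat{w_{ij}})=m r^{j-5}(\widehat{w_{1,i}}-w_{1,i})+m r^{j-4}(\widehat{w_{2,i}}-w_{2,i})+m r^{i-3}(\widehat{w_{1,j}}-w_{1,j})+m r^{i-2}(\widehat{w_{2,j}}-w_{2,j})+m^2(r^{i+j-8}+r^{i+j-6})(\widehat{w_{12}}-w_{12})+r\,\widehat{w_{ij}}$; for $j\ge3$: $\nu_1(\widehat{w_{1j}})=w_{2j}$, $\nu_1(\widehat{w_{2j}})=w_{1j}+m r^{j-3}w_{12}-m\,w_{2j}$, $\nu_1(w_{2j})=\widehat{w_{1j}}+m r^{j-3}\widehat{w_{12}}-m\,w_{2j}$, $\nu_1(w_{1j})=\widehat{w_{2j}}+m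 r^{j-4}(\widehat{w_{12}}-w_{12})+m(\widehat{w_{1j}}-w_{1j})$; $\nu_1(\widehat{w_{12}})=\frac1l\widehat{w_{12}}$; $\nu_1(\overline{w_{s,t}})=r\,\overline{w_{s,t}}$ for all other basis vectors. $\nu_k$, $2\le k\le n$: $\nu_k(\overline{w_{k-1,t}})=\overline{w_{k,t}}$ for $t\ge k+1$; $\nu_k(\overline{w_{s,k-1}})=\overline{w_{s,k}}$ for $s\le k-2$; $\nu_k(\widehat{w_{k-1,k}})=r\,\widehat{w_{k-1,k}}$; $\nu_k(w_{k-1,k})=\frac1lw_{k-1,k}$; for $t\ge k+1$: $\nu_k(\widehat{w_{k,t}})=\widehat{w_{k-1,t}}+\frac ml r^{t-k-2}w_{k-1,k}-m\,\widehat{w_{k,t}}$ and $\nu_k(w_{k,t})=w_{k-1,t}+m r^{t-k-1}w_{k-1,k}-m\,w_{k,t}$; for $s\le k-2$: $\nu_k(\overline{w_{s,k}})=\overline{w_{s,k-1}}+\frac{m}{l\,r^{k-s-2}}w_{k-1,k}-m\,\overline{w_{s,k}}$; $\nu_k(\overline{w_{s,t}})=r\,\overline{w_{s,t}}$ for all other basis vectors. An invariant subspace of $V_n$ is an $F$-subspace stable under all $\nu_1,\dots,\nu_n$; it is irreducible if it is nonzero and has no invariant subspaces other than $0$ and itself. $\mathcal H(D_n)$ is the $F$-algebra with generators $g_1,\dots,g_n$, the Artin relations of type $D_n$ (node $1$ joined to node $3$, node $i$ joined to $i+1$ for $2\le i\le n-1$) and $g_i^2+mg_i=1$; $\mathcal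 H_{F,r^2}(n)$ is the Iwahori--Hecke algebra of $\mathrm{Sym}(n)$ with parameter $r^2$ over $F$. *)

(* Defs.v *)
From HB Require Import structures.
From mathcomp Require Import all_boot all_order all_algebra.
From mathcomp Require Import boolp.

Set Implicit Arguments.
Unset Strict Implicit.
Unset Printing Implicit Defensive.

Import GRing.Theory.
Local Open Scope ring_scope.

Section RationalSubfield.
Variables (C : fieldType) (l r : C).

(* The smallest subfield of C containing l and r: in a field, divring_closed
   says that S contains 1 and is stable under subtraction and division. *)
Definition mem_Qadj : {pred C} :=
  [pred x | `[< forall S : {pred C},
     divring_closed S -> l \in S -> r \in S -> x \in S >]].

Fact mem_Qadj_divring : divring_closed mem_Qadj.
Proof.
split=> [|x y|x y].
- by rewrite inE; apply/asboolP => S [].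
- rewrite !inE => /asboolP xP /asboolP yP; apply/asboolP => S dS Sl Sr.
  by case: (dS) => _ SB _; apply: SB; [apply: xP | apply: yP].
- rewrite !inE => /asboolP xP /asboolP yP; apply/asboolP => S dS Sl Sr.
  by case: (dS) => _ _ SV; apply: SV; [apply: xP | apply: yP].
Qed.

HB.instance Definition _ := GRing.isDivringClosed.Build C mem_Qadj
  mem_Qadj_divring.

Definition Qadj : Type := {x : C | x \in mem_Qadj}.
HB.instance Definition _ := SubType.on Qadj.
HB.instance Definition _ := [Choice of Qadj by <:].
HB.instance Definition _ := [SubChoice_isSubIntegralDomain of Qadj by <:].
HB.instance Definition _ := [SubIntegralDomain_isSubField of Qadj by <:].

Fact Qadj_l_subproof : l \in mem_Qadj.
Proof. by rewrite inE; apply/asboolP. Qed.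

Fact Qadj_r_subproof : r \in mem_Qadj.
Proof. by rewrite inE; apply/asboolP. Qed.

Definition Qadj_l : Qadj := exist _ l Qadj_l_subproof.
Definition Qadj_r : Qadj := exist _ r Qadj_r_subproof.

End RationalSubfield.

(* The pairs (i, j) of naturals with 1 <= i < j <= n. *)
Definition ipair (n : nat) : Type :=
  {p : 'I_n.+1 * 'I_n.+1 | (0 < p.1 < p.2)%N}.
HB.instance Definition _ n := SubFinite.on (ipair n).

(* The first component is true on hatted basis vectors, false on plain ones. *)
Definition V (F : fieldType) (n : nat) : Type := {ffun bool * ipair n -> F^o}.
HB.instance Definition _ F n := Vector.on (V F n).

Section Representation.
Variables (F : fieldType) (l r : F) (n : nat).

(* Basis vectors with natural-number labels; junk value 0 unless
   1 <= i < j <= n. *)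
Definition wvec (hat : bool) (i j : nat) : V F n :=
  [ffun x : bool * ipair n => ((x.1 == hat) &&
     (((val x.2).1 == i :> nat) && ((val x.2).2 == j :> nat)))%:R : F^o].

Let w := wvec false.
Let wh := wvec true.
Let m : F := r^-1 - r.

Definition nu1_val (hat : bool) (i j : nat) : V F n :=
  if hat then
    if (3 <= i)%N then
      (m * r ^ (j%:Z - 5)) *: (wh 1 i - w 1 i)
      + (m * r ^ (j%:Z - 4)) *: (wh 2 i - w 2 i)
      + (m * r ^ (i%:Z - 3)) *: (wh 1 j - w 1 j)
      + (m * r ^ (i%:Z - 2)) *: (wh 2 j - w 2 j)
      + (m ^+ 2 * (r ^ (i%:Z + j%:Z - 8) + r ^ (i%:Z + j%:Z - 6)))
          *: (wh 1 2 - w 1 2)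
      + r *: wh i j
    else if (3 <= j)%N then
      if i == 1 then w 2 j
      else w 1 j + (m * r ^ (j%:Z - 3)) *: w 1 2 - m *: w 2 j
    else l^-1 *: wh 1 2
  else
    if (i == 2) && (3 <= j)%N then
      wh 1 j + (m * r ^ (j%:Z - 3)) *: wh 1 2 - m *: w 2 j
    else if (i == 1) && (3 <= j)%N then
      wh 2 j + (m * r ^ (j%:Z - 4)) *: (wh 1 2 - w 1 2) + m *: (wh 1 j - w 1 j)
    else r *: w i j.

(* For 2 <= k. *)
Definition nuk_val (k : nat) (hat : bool) (s t : nat) : V F n :=
  if (s == k.-1) && (t == k) then
    if hat then r *: wh s t else l^-1 *: w s t
  else if s == k.-1 then wvec hat k t
  else if t == k.-1 then wvec hat s k
  else if s == k then
    if hat then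
      wh k.-1 t + (m / l * r ^ (t%:Z - k%:Z - 2)) *: w k.-1 k - m *: wh k t
    else w k.-1 t + (m * r ^ (t%:Z - k%:Z - 1)) *: w k.-1 k - m *: w k t
  else if t == k then
    wvec hat s k.-1 + (m / (l * r ^ (k%:Z - s%:Z - 2))) *: w k.-1 k
      - m *: wvec hat s k
  else r *: wvec hat s t.

Definition nu_val (k : nat) (hat : bool) (s t : nat) : V F n :=
  if k == 1 then nu1_val hat s t else nuk_val k hat s t.

Definition nu_fun (k : nat) (v : V F n) : V F n :=
  \sum_(x : bool * ipair n) v x *: nu_val k x.1 (val x.2).1 (val x.2).2.

Fact nu_fun_linear k : linear (nu_fun k).
Proof.
move=> a u v; rewrite /nu_fun scaler_sumr -big_split /=.
by apply: eq_bigr => x _; rewrite !ffunE scalerDl scalerA.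
Qed.

HB.instance Definition _ k :=
  GRing.isLinear.Build F (V F n) (V F n) _ (nu_fun k) (nu_fun_linear k).

Definition nu (k : nat) : 'End(V F n) := linfun (nu_fun k).

Lemma nu_wvec k hat i j : (0 < i < j)%N -> (j <= n)%N ->
  nu k (wvec hat i j) = nu_val k hat i j.
Proof.
move=> ij jn; have [i0 lt_ij] := andP ij.
have jn1 : (j < n.+1)%N by [].
have in1 : (i < n.+1)%N by apply: ltn_trans lt_ij jn1.
pose x0 : bool * ipair n := (hat, exist _ (Ordinal in1, Ordinal jn1) ij).
rewrite /nu lfunE /= /nu_fun (bigD1 x0) //= ffunE /= !eqxx scale1r.
rewrite big1 ?addr0 // => -[h [[a b] ab]] ne; rewrite ffunE /=.
case: eqP => [eh|_] /=; last by rewrite scale0r.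
case: eqP => [ea|_] /=; last by rewrite scale0r.
case: eqP => [eb|_] /=; last by rewrite scale0r.
case/negP: ne; rewrite /x0 eh; apply/eqP; congr (_, _).
by apply: val_inj => /=; congr (_, _); apply: val_inj.
Qed.

Definition invariant_subspace (U : {vspace V F n}) : Prop :=
  forall k : nat, (1 <= k <= n)%N -> (nu k @: U <= U)%VS.

Definition irreducible_invariant (U : {vspace V F n}) : Prop :=
  [/\ invariant_subspace U, U <> 0%VS &
      forall W : {vspace V F n}, invariant_subspace W -> (W <= U)%VS ->
        W = 0%VS \/ W = U].

End Representation.

(* Main.v *)
From HB Require Import structures.
Require Import Defs.
From mathcomp Require Import all_boot all_order all_algebra.
From mathcomp Require Import reals complex.
From mathcomp Require Import zify ring.
Import GRing.Theory.
Local Open Scope ring_scope.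
Local Open Scope complex_scope.

Set Implicit Arguments.
Unset Strict Implicit.
Unset Printing Implicit Defensive.

(** Let U be an invariant subspace of dimension D = n(n-3)/2, p = 1/l and
m = 1/r - r; the claim is p = r^-3.

Each nu_k with k >= 2 is a Hecke operator up to a rank one term: the image of
nu_k^2 + m nu_k - 1 lies on the line of the root vector w_(k-1,k). If that root
vector lay in U, then all basis vectors would, and U would be the whole space
([full_of_root]). On a proper U the quadratic relation therefore holds exactly
([hecke_on]): there nu_k has only the eigenvalues r and -1/r, and
(nu_k - r) U consists of (-1/r)-eigenvectors.

First case: some nonzero v in U satisfies nu_2 v = nu_4 v = - v / r; this
includes the case of the whole space. Comparing coordinates, v is a quantum
polytabloid
  a (w_13 - w_23/r - w_14/r + w_24/r^2) + b (the same in hatted vectors)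
([polab_shape]), and after applying nu_1 one may assume b <> 0. Applying
nu_2, ..., nu_n produces D vectors of U, namely the polytabloids on
(i,i+1 ; j,j+1) with i + 2 <= j and the vectors nu_(i+2) of the polytabloids on
(i,i+1 ; i+2,i+3). Their hatted coordinates are triangular for the order of
i + j, so they are independent ([fam_free]) and span U when dim U = D; this is
the q-analogue of the standard basis of the Specht module of shape (n-2,2).
Three linear functionals kill this family: kappa 1 3, kappa 1 4, where
kappa i j = a (hatted coordinate) - b (plain coordinate), and the total weight
theta = sum of r^(i+j) times the hatted coordinates. They must then kill
nu_1 nu_3 v, which lies in U as well. The resulting equations
  (b/r^2 - a)(a + b) = 0,  kappa 1 3 = 0,  (p + r^-3)(b/r^2 - a) = 0
leave only p = r^-3 ([p_mul_r3_of_polytabloid]).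

Second case: there is no such v. By the commutation and braid relations, every
(-1/r)-eigenvector u of nu_2 in U is multiplied by r under nu_4, ..., nu_n
([eig2_inv]). It is then determined by its three coordinates
a = w_13, b = hatted w_13, x = w_12, which satisfy one relation from
nu_2 u = - u / r and a second one from the fact that (nu_2 - r) nu_3 u is again
such an eigenvector. Eliminating x leaves a nontrivial linear relation between
a and b, so nu_2 - r has rank at most 1 on U ([eig2_scalar]); by the braid
relation so does nu_k - r for 2 <= k <= n ([rank_N]). The vectors of U that
nu_2, ..., nu_n all multiply by r thus form a subspace of codimension at most
n - 1; such a vector is determined by its two coordinates on the labels (1,2), hence
dim U <= n + 1 ([dim_le_succ]), which is less than D for n >= 6. *)

(** * Coordinates in the basis of V *)

Section BasisCoordinates.
Variables (F : fieldType) (n : nat).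

(** The coordinate on the basis vector with label (i, j), hatted when [h] is true;
it is 0 when (i, j) is not the label of a basis vector. *)
Definition wcoef (h : bool) (i j : nat) (v : V F n) : F :=
  \sum_(x : bool * ipair n) (v x : F) *
    ((x.1 == h) && (((val x.2).1 == i :> nat) && ((val x.2).2 == j :> nat)))%:R.

Lemma wcoef_is_linear h i j : linear_for *%R (wcoef h i j).
Proof.
move=> a u v; rewrite /wcoef mulr_sumr -big_split /=.
by apply: eq_bigr => x _; rewrite !ffunE mulrDl mulrA.
Qed.

HB.instance Definition _ h i j :=
  GRing.isLinear.Build F (V F n) F *%R (wcoef h i j) (wcoef_is_linear h i j).

Lemma wcoef_wvec h i j h' i' j' : (0 < i < j)%N -> (j <= n)%N ->
  wcoef h i j (wvec F n h' i' j') = ((h' == h) && ((i' == i) && (j' == j)))%:R.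
Proof.
move=> ij jn; have [i0 lt_ij] := andP ij.
have jn1 : (j < n.+1)%N by [].
have in1 : (i < n.+1)%N by apply: ltn_trans lt_ij jn1.
pose x0 : bool * ipair n := (h, exist _ (Ordinal in1, Ordinal jn1) ij).
rewrite /wcoef (bigD1 x0) //= !ffunE /= !eqxx mulr1 big1 ?addr0.
  by rewrite (eq_sym h) (eq_sym i) (eq_sym j).
move=> -[h1 [[a b] ab]] ne; rewrite !ffunE /=.
case: (h1 =P h) => [eh|_] /=; last exact: mulr0.
case: (nat_of_ord a =P i) => [ea|_] /=; last exact: mulr0.
case: (nat_of_ord b =P j) => [eb|_] /=; last exact: mulr0.
case/negP: ne; rewrite /x0 eh; apply/eqP; congr (_, _).
by apply: val_inj => /=; congr (_, _); apply: val_inj.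
Qed.

Lemma wcoefE (x : bool * ipair n) v : wcoef x.1 (val x.2).1 (val x.2).2 v = v x.
Proof.
rewrite /wcoef (bigD1 x) //= !eqxx mulr1 big1 ?addr0 // => y ne.
case: eqP => [e1|_] /=; last exact: mulr0.
case: eqP => [e2|_] /=; last exact: mulr0.
case: eqP => [e3|_] /=; last exact: mulr0.
case/negP: ne; move: x y e1 e2 e3 => [h [[a b] ab]] [h' [[a' b'] ab']] /= -> e2 e3.
by apply/eqP; congr (_, _); apply: val_inj => /=; congr (_, _); apply: val_inj.
Qed.

Lemma vec_eq (u v : V F n) :
  (forall h i j, (0 < i < j)%N -> (j <= n)%N -> wcoef h i j u = wcoef h i j v) -> u = v.
Proof.
move=> H; apply/ffunP => -[h [[a b] ab]].
rewrite -(wcoefE (h, exist _ (a, b) ab) u) -(wcoefE (h, exist _ (a, b) ab) v).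
by apply: H => //=; rewrite -ltnS.
Qed.

Lemma vec_decomp (v : V F n) :
  v = \sum_(x : bool * ipair n) v x *: wvec F n x.1 (val x.2).1 (val x.2).2.
Proof.
apply: vec_eq => h i j ij jn; rewrite linear_sum /wcoef; apply: eq_bigr => x _.
by rewrite linearZ /= wcoef_wvec.
Qed.

Lemma vec_ind (P : V F n -> Prop) :
  P 0 -> (forall a u v, P u -> P v -> P (a *: u + v)) ->
  (forall h i j, (0 < i < j)%N -> (j <= n)%N -> P (wvec F n h i j)) -> forall v, P v.
Proof.
move=> P0 PD Pw v; rewrite (vec_decomp v); elim/big_rec: _ => // -[h [[a b] ab]] u _ Pu.
by apply: PD => //; apply: Pw => //=; rewrite -ltnS.
Qed.

End BasisCoordinates.

(* Decides the equality tests between labels that occur in the goal. *)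
Ltac natcond :=
  repeat match goal with
  | |- context [@eq_op ?T ?a ?b] =>
      lazymatch type of a with
      | nat => first [ rewrite (_ : (@eq_op T a b) = false); [|apply/negbTE/eqP; lia]
              | rewrite (_ : (@eq_op T a b) = true); [|apply/eqP; lia] ]
      end
  end.

(** * The operators on the basis vectors *)

Section BasisRules.
Variables (F : fieldType) (l r : F) (n : nat).

Local Notation m := (r^-1 - r).
Local Notation p := (l^-1).
Local Notation nu := (nu l r n).
Local Notation w := (wvec F n).

Lemma nuk_wvec k h s t : (2 <= k)%N -> (0 < s < t)%N -> (t <= n)%N ->
  nu k (w h s t) = nuk_val l r n k h s t.
Proof. by move=> k2 st tn; rewrite nu_wvec // /nu_val; case: eqP => // k1; lia. Qed.

(** The action of nu_k, k >= 2, on the six kinds of labels (s, t): both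
indices, or exactly one of them, among k - 1 and k, or none. *)
Lemma nuk_root k h : (2 <= k <= n)%N ->
  nu k (w h k.-1 k) = (if h then r else p) *: w h k.-1 k.
Proof.
move=> kn; rewrite nuk_wvec /nuk_val ?eqxx /=; try lia.
by case: h.
Qed.

Lemma nuk_lt k h t : (2 <= k < t)%N -> (t <= n)%N ->
  nu k (w h k.-1 t) = w h k t.
Proof. by move=> kn tn; rewrite nuk_wvec /nuk_val; try lia; natcond. Qed.

Lemma nuk_gt k h s : (0 < s < k.-1)%N -> (k <= n)%N ->
  nu k (w h s k.-1) = w h s k.
Proof. by move=> kn tn; rewrite nuk_wvec /nuk_val; try lia; natcond. Qed.

Lemma nuk_l k h t : r != 0 -> (2 <= k < t)%N -> (t <= n)%N ->
  nu k (w h k t) = w h k.-1 t +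
   ((if h then p / r else 1) * m * r ^+ (t - k.+1)) *: w false k.-1 k - m *: w h k t.
Proof.
move=> r0 kn tn; rewrite nuk_wvec /nuk_val; try lia; natcond.
rewrite (_ : t%:Z - k%:Z - 1 = (t - k.+1)%N); last lia.
rewrite (_ : t%:Z - k%:Z - 2 = (t - k.+1)%N%:Z + (- 1)%Z); last lia.
rewrite expfzDr // exprN1 -!exprnP.
case: h; rewrite ?mul1r //; congr (_ + _ - _); congr (_ *: _); ring.
Qed.

Lemma nuk_r k h s : (0 < s < k.-1)%N -> (k <= n)%N ->
  nu k (w h s k) = w h s k.-1 +
   (p * m * r ^- (k.-2 - s)) *: w false k.-1 k - m *: w h s k.
Proof.
move=> kn tn; rewrite nuk_wvec /nuk_val; try lia; natcond.
rewrite (_ : k%:Z - s%:Z - 2 = (k.-2 - s)%N); last lia.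
congr (_ + _ - _); congr (_ *: _); rewrite -exprnP invfM; ring.
Qed.

Lemma nuk_other k h s t : (2 <= k)%N -> (0 < s < t)%N -> (t <= n)%N ->
  s != k -> s != k.-1 -> t != k -> t != k.-1 ->
  nu k (w h s t) = r *: w h s t.
Proof. by move=> k2 st tn s1 s2 t1 t2; rewrite nuk_wvec /nuk_val; try lia; natcond. Qed.

Lemma nu1_w2 j : (3 <= j <= n)%N ->
  nu 1 (w false 2 j) = w true 1 j + (m * r ^+ (j - 3)) *: w true 1 2 - m *: w false 2 j.
Proof.
move=> jn; rewrite nu_wvec /nu_val /nu1_val; try lia.
rewrite (_ : (3 <= j)%N) /=; last lia.
by rewrite exprnP (_ : j%:Z - 3 = (j - 3)%N) //; lia.
Qed.

Lemma nu1_w1 j : r != 0 -> (3 <= j <= n)%N ->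
  nu 1 (w false 1 j) = w true 2 j + (m * r ^+ (j - 3) / r) *: (w true 1 2 - w false 1 2)
    + m *: (w true 1 j - w false 1 j).
Proof.
move=> r0 jn; rewrite nu_wvec /nu_val /nu1_val; try lia.
rewrite (_ : (3 <= j)%N) /=; last lia.
rewrite (_ : j%:Z - 4 = (j - 3)%N%:Z + (- 1)%Z); last lia.
by rewrite expfzDr // exprN1 -exprnP mulrA.
Qed.

Lemma nu1_w12 : (2 <= n)%N -> nu 1 (w false 1 2) = r *: w false 1 2.
Proof. by move=> n2; rewrite nu_wvec. Qed.

Lemma nu1_w i j : (3 <= i < j)%N -> (j <= n)%N -> nu 1 (w false i j) = r *: w false i j.
Proof.
move=> ij jn; rewrite nu_wvec /nu_val /nu1_val; try lia.
by rewrite eqxx; do 2 (case: eqP => [?|_] /=; first by lia).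
Qed.

Lemma nu1_h1 j : (3 <= j <= n)%N -> nu 1 (w true 1 j) = w false 2 j.
Proof.
move=> jn; rewrite nu_wvec /nu_val /nu1_val; try lia.
by rewrite (_ : (3 <= j)%N) //=; lia.
Qed.

Lemma nu1_h2 j : (3 <= j <= n)%N ->
  nu 1 (w true 2 j) = w false 1 j + (m * r ^+ (j - 3)) *: w false 1 2 - m *: w false 2 j.
Proof.
move=> jn; rewrite nu_wvec /nu_val /nu1_val; try lia.
rewrite (_ : (3 <= j)%N) /=; last lia.
by rewrite exprnP (_ : j%:Z - 3 = (j - 3)%N) //; lia.
Qed.

Lemma nu1_h12 : (2 <= n)%N -> nu 1 (w true 1 2) = p *: w true 1 2.
Proof. by move=> n2; rewrite nu_wvec. Qed.

(** The coefficients are separate arguments so that the powers of r can be given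
in simplified form. *)
Lemma nu1_h i j a1 a2 a3 a4 a5 : (3 <= i < j)%N -> (j <= n)%N ->
  a1 = m * r ^ (j%:Z - 5) -> a2 = m * r ^ (j%:Z - 4) -> a3 = m * r ^ (i%:Z - 3) ->
  a4 = m * r ^ (i%:Z - 2) -> a5 = m ^+ 2 * (r ^ (i%:Z + j%:Z - 8) + r ^ (i%:Z + j%:Z - 6)) ->
  nu 1 (w true i j) = a1 *: (w true 1 i - w false 1 i) + a2 *: (w true 2 i - w false 2 i)
   + a3 *: (w true 1 j - w false 1 j) + a4 *: (w true 2 j - w false 2 j)
   + a5 *: (w true 1 2 - w false 1 2) + r *: w true i j.
Proof.
move=> ij jn -> -> -> -> ->; rewrite nu_wvec /nu_val /nu1_val; [|lia|lia].
by case: ifP => [//|]; lia.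
Qed.

Lemma nu1_h34 : (4 <= n)%N ->
  nu 1 (w true 3 4) = (m / r) *: (w true 1 3 - w false 1 3) + m *: (w true 2 3 - w false 2 3)
   + m *: (w true 1 4 - w false 1 4) + (m * r) *: (w true 2 4 - w false 2 4)
   + (m ^+ 2 * (r^-1 + r)) *: (w true 1 2 - w false 1 2) + r *: w true 3 4.
Proof.
move=> n4; apply: nu1_h => //.
- by rewrite -[LHS]mulr1; exact: (congr1 (fun x => m * x) (esym (expr0z r))).
by rewrite -[LHS]mulr1; exact: (congr1 (fun x => m * x) (esym (expr0z r))).
Qed.

End BasisRules.

(** * An abstract form of the representation *)

Section CgwModel.
Variables (F : fieldType) (p r : F) (n : nat).
Local Notation m := (r^-1 - r).

(** A vector space with the basis, the coordinates and the operators of V_n,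
presented by the rules they satisfy, with p for 1/l. Only the values of
nu_1 that the argument uses are listed; [e] is an exponent of r determined by
the labels. Everything below is derived from these rules, and the definitions
of the operators are unfolded only to build [V_model]. *)
Record cgw_model := CgwModel {
  cgw_space : vectType F;
  cgw_w : bool -> nat -> nat -> cgw_space;
  cgw_nu : nat -> 'End(cgw_space);
  cgw_co : bool -> nat -> nat -> {scalar cgw_space};
  cgw_co_w : forall h i j h' i' j', (0 < i < j)%N -> (j <= n)%N ->
    cgw_co h i j (cgw_w h' i' j') = ((h' == h) && ((i' == i) && (j' == j)))%:R;
  cgw_ext : forall u v,
    (forall h i j, (0 < i < j)%N -> (j <= n)%N -> cgw_co h i j u = cgw_co h i j v) -> u = v;
  cgw_ind : forall P : cgw_space -> Prop,
    P 0 -> (forall a u v, P u -> P v -> P (a *: u + v)) ->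
    (forall h i j, (0 < i < j)%N -> (j <= n)%N -> P (cgw_w h i j)) -> forall v, P v;
  N_root : forall k h s t, (2 <= k <= n)%N -> s = k.-1 -> t = k ->
    cgw_nu k (cgw_w h s t) = (if h then r else p) *: cgw_w h s t;
  N_lt : forall k h s t, s = k.-1 -> (2 <= k < t)%N -> (t <= n)%N ->
    cgw_nu k (cgw_w h s t) = cgw_w h k t;
  N_gt : forall k h s t, t = k.-1 -> (0 < s < k.-1)%N -> (k <= n)%N ->
    cgw_nu k (cgw_w h s t) = cgw_w h s k;
  N_l : forall k h s t e, s = k -> (2 <= k < t)%N -> (t <= n)%N -> (e + k.+1)%N = t ->
    cgw_nu k (cgw_w h s t) = cgw_w h k.-1 t +
     ((if h then p / r else 1) * m * r ^+ e) *: cgw_w false k.-1 k - m *: cgw_w h k t;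
  N_r : forall k h s t e, t = k -> (0 < s < k.-1)%N -> (k <= n)%N -> (e + s)%N = k.-2 ->
    cgw_nu k (cgw_w h s t) = cgw_w h s k.-1 +
     (p * m * r ^- e) *: cgw_w false k.-1 k - m *: cgw_w h s k;
  N_other : forall k h s t, (2 <= k)%N -> (0 < s < t)%N -> (t <= n)%N ->
    s != k -> s != k.-1 -> t != k -> t != k.-1 ->
    cgw_nu k (cgw_w h s t) = r *: cgw_w h s t;
  N1_w12 : (2 <= n)%N -> cgw_nu 1 (cgw_w false 1 2) = r *: cgw_w false 1 2;
  N1_w1 : forall j, (3 <= j <= n)%N ->
    cgw_nu 1 (cgw_w false 1 j) = cgw_w true 2 j
      + (m * r ^+ (j - 3) / r) *: (cgw_w true 1 2 - cgw_w false 1 2)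
      + m *: (cgw_w true 1 j - cgw_w false 1 j);
  N1_w2 : forall j, (3 <= j <= n)%N ->
    cgw_nu 1 (cgw_w false 2 j) = cgw_w true 1 j
      + (m * r ^+ (j - 3)) *: cgw_w true 1 2 - m *: cgw_w false 2 j;
  N1_w : forall i j, (3 <= i < j)%N -> (j <= n)%N ->
    cgw_nu 1 (cgw_w false i j) = r *: cgw_w false i j;
  N1_h12 : (2 <= n)%N -> cgw_nu 1 (cgw_w true 1 2) = p *: cgw_w true 1 2;
  N1_h1 : forall j, (3 <= j <= n)%N -> cgw_nu 1 (cgw_w true 1 j) = cgw_w false 2 j;
  N1_h2 : forall j, (3 <= j <= n)%N ->
    cgw_nu 1 (cgw_w true 2 j) = cgw_w false 1 j
      + (m * r ^+ (j - 3)) *: cgw_w false 1 2 - m *: cgw_w false 2 j;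
  N1_h34 : (4 <= n)%N ->
    cgw_nu 1 (cgw_w true 3 4) =
     (m / r) *: (cgw_w true 1 3 - cgw_w false 1 3) + m *: (cgw_w true 2 3 - cgw_w false 2 3)
     + m *: (cgw_w true 1 4 - cgw_w false 1 4) + (m * r) *: (cgw_w true 2 4 - cgw_w false 2 4)
     + (m ^+ 2 * (r^-1 + r)) *: (cgw_w true 1 2 - cgw_w false 1 2) + r *: cgw_w true 3 4
}.

Lemma scalar_ext (X : cgw_model) (f g : cgw_space X -> F) v :
  linear_for *%R f -> linear_for *%R g ->
  (forall h i j, (0 < i < j)%N -> (j <= n)%N -> f (cgw_w X h i j) = g (cgw_w X h i j)) -> f v = g v.
Proof.
move=> fL gL; have lin0 g1 : linear_for *%R g1 -> g1 0 = 0 :> F.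
  by move=> gL1; have := gL1 (- 1) 0 0; rewrite scaler0 addr0 mulN1r addNr.
elim/cgw_ind: v => [|a u v IHu IHv|h i j ij jn] H; last exact: H.
  by rewrite !lin0.
by rewrite fL gL IHu ?IHv.
Qed.

Lemma lin_ext (X : cgw_model) (f g : {linear cgw_space X -> cgw_space X}) v :
  (forall h i j, (0 < i < j)%N -> (j <= n)%N -> f (cgw_w X h i j) = g (cgw_w X h i j)) -> f v = g v.
Proof.
elim/cgw_ind: v => [|a u v IHu IHv|h i j ij jn] H; last exact: H.
  by rewrite !linear0.
by rewrite !linearP IHu ?IHv.
Qed.

(** The position of a label (s, t) with respect to {k - 1, k}. *)
Inductive label_spec (k s t : nat) : Prop :=
| LabelRoot of s = k.-1 & t = k
| LabelLt of s = k.-1 & (k < t)%N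
| LabelL of s = k & (k < t)%N
| LabelGt of (s < k.-1)%N & t = k.-1
| LabelR of (s < k.-1)%N & t = k
| LabelOther of s != k & s != k.-1 & t != k & t != k.-1.

Lemma labelP k s t : (2 <= k)%N -> (0 < s < t)%N -> label_spec k s t.
Proof.
move=> k2 st.
case: (eqVneq s k) => [e|e1]; first by apply: LabelL; lia.
case: (eqVneq s k.-1) => [e|e2].
  by case: (eqVneq t k) => [e'|e3]; [apply: LabelRoot | apply: LabelLt; lia].
case: (eqVneq t k) => [e|e3]; first by apply: LabelR; lia.
case: (eqVneq t k.-1) => [e|e4]; first by apply: LabelGt; lia.
exact: LabelOther.
Qed.

End CgwModel.

Section ModelLinearity.
Variables (F : fieldType) (p r : F) (n : nat) (X : cgw_model p r n).

Lemma nuD k u v : cgw_nu X k (u + v) = cgw_nu X k u + cgw_nu X k v.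
Proof. exact: linearD. Qed.
Lemma nuN k u : cgw_nu X k (- u) = - cgw_nu X k u.
Proof. exact: linearN. Qed.
Lemma nuZ k a u : cgw_nu X k (a *: u) = a *: cgw_nu X k u.
Proof. exact: linearZ. Qed.
Lemma coD h i j u v : cgw_co X h i j (u + v) = cgw_co X h i j u + cgw_co X h i j v.
Proof. exact: linearD. Qed.
Lemma coN h i j u : cgw_co X h i j (- u) = - cgw_co X h i j u.
Proof. exact: linearN. Qed.
Lemma coZ h i j a u : cgw_co X h i j (a *: u) = a * cgw_co X h i j u.
Proof. exact: linearZ. Qed.

Lemma vec_ext (u v : cgw_space X) :
  (forall h i j, cgw_co X h i j u = cgw_co X h i j v) -> u = v.
Proof. by move=> H; apply: cgw_ext. Qed.

End ModelLinearity.

(* Proves an identity between vectors coordinate by coordinate. *)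
Ltac vec_field :=
  match goal with
  | |- context [cgw_w ?X] =>
    apply: (@vec_ext _ _ _ _ X) => ? ? ?;
    rewrite ?(@coD _ _ _ _ X, @coN _ _ _ _ X, @coZ _ _ _ _ X) /= ?expr0 ?exprS
  | |- _ => apply: vec_ext => ? ? ?; rewrite ?(coD, coN, coZ) /= ?expr0 ?exprS
  end;
  field; do ?[apply/andP; split]; rewrite ?expf_neq0 ?oner_eq0 //.

(* Evaluates one operator on a basis vector; the exponent of r in the result is
   e, e + 1 or 0. *)
Ltac N_step e :=
  match goal with
  | |- context [fun_of_lfun (@cgw_nu _ _ _ _ ?X ?k) (@cgw_w _ _ _ _ _ ?h ?s ?t)] =>
    first
    [ rewrite (@N_root _ _ _ _ X k h s t); [|lia|lia|lia]
    | rewrite (@N_lt _ _ _ _ X k h s t); [|lia|lia|lia]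
    | rewrite (@N_gt _ _ _ _ X k h s t); [|lia|lia|lia]
    | rewrite (@N_other _ _ _ _ X k h s t); [|lia|lia|lia|lia|lia|lia|lia]
    | rewrite (@N_l _ _ _ _ X k h s t e); [|lia|lia|lia|lia]
    | rewrite (@N_l _ _ _ _ X k h s t e.+1); [|lia|lia|lia|lia]
    | rewrite (@N_l _ _ _ _ X k h s t 0%N); [|lia|lia|lia|lia]
    | rewrite (@N_r _ _ _ _ X k h s t e); [|lia|lia|lia|lia]
    | rewrite (@N_r _ _ _ _ X k h s t e.+1); [|lia|lia|lia|lia]
    | rewrite (@N_r _ _ _ _ X k h s t 0%N); [|lia|lia|lia|lia] ];
    rewrite ?(@nuD _ _ _ _ X, @nuN _ _ _ _ X, @nuZ _ _ _ _ X) /=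
  end.

(** * Coordinates of nu_k v *)

Section ModelCoordinates.
Variables (F : fieldType) (p r : F) (n : nat) (X : cgw_model p r n).
Hypothesis r0 : r != 0.
Local Notation m := (r^-1 - r).
Local Notation W := (cgw_w X).
Local Notation N := (cgw_nu X).
Local Notation co := (cgw_co X).

Ltac linear_tac := move=> ? ? ?; rewrite !(nuD, nuZ, coD, coZ); ring.

(* Evaluates nu_k on the basis vector labelled (s, t), in each of the six
   positions. *)
Ltac N_cases k h s t k2 st tn :=
  case: (labelP k2 st) => [es et|es lt|es lt|lt et|lt et|s1 s2 t1 t2]; try subst s; try subst t;
  [ rewrite N_root; [|lia|lia|lia]
  | rewrite N_lt; [|lia|lia|lia]
  | rewrite (@N_l _ _ _ _ _ _ _ _ _ (t - k.+1)%N); [|lia|lia|lia|lia]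
  | rewrite N_gt; [|lia|lia|lia]
  | rewrite (@N_r _ _ _ _ _ _ _ _ _ (k.-2 - s)%N); [|lia|lia|lia|lia]
  | rewrite N_other; [|lia|lia|lia|by []|by []|by []|by []] ].

Ltac co_close :=
  rewrite ?(coD, coN, coZ) ?cgw_co_w; try lia; natcond;
  rewrite ?(andbF, andbT, mulr0, mulr1, subr0, addr0, sub0r, add0r, oppr0) //=.

Lemma co_N_lt k h t v : (2 <= k < t)%N -> (t <= n)%N ->
  co h k.-1 t (N k v) = co h k t v.
Proof.
move=> kt tn; have k2 : (2 <= k)%N by lia.
apply: (@scalar_ext _ _ _ _ X (fun v => co h k.-1 t (N k v)) (fun v => co h k t v));
  [linear_tac|linear_tac|] => h' s' t' st' tn'.
by N_cases k h' s' t' k2 st' tn'; co_close.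
Qed.

Lemma co_N_gt k h s v : (0 < s < k.-1)%N -> (k <= n)%N ->
  co h s k.-1 (N k v) = co h s k v.
Proof.
move=> sk kn; have k2 : (2 <= k)%N by lia.
apply: (@scalar_ext _ _ _ _ X (fun v => co h s k.-1 (N k v)) (fun v => co h s k v));
  [linear_tac|linear_tac|] => h' s' t' st' tn'.
by N_cases k h' s' t' k2 st' tn'; co_close.
Qed.

Lemma co_N_r k h s v : (0 < s < k.-1)%N -> (k <= n)%N ->
  co h s k (N k v) = co h s k.-1 v - m * co h s k v.
Proof.
move=> sk kn; have k2 : (2 <= k)%N by lia.
apply: (@scalar_ext _ _ _ _ X (fun v => co h s k (N k v))
  (fun v => co h s k.-1 v - m * co h s k v)); [linear_tac|linear_tac|] => h' s' t' st' tn'.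
by N_cases k h' s' t' k2 st' tn'; co_close.
Qed.

Lemma co_N_other k h s t v : (2 <= k <= n)%N -> (0 < s < t)%N -> (t <= n)%N ->
  s != k -> s != k.-1 -> t != k -> t != k.-1 ->
  co h s t (N k v) = r * co h s t v.
Proof.
move=> kn st tn a1 a2 a3 a4; have k2 : (2 <= k)%N by lia.
apply: (@scalar_ext _ _ _ _ X (fun v => co h s t (N k v)) (fun v => r * co h s t v));
  [linear_tac|linear_tac|] => h' s' t' st' tn'.
by N_cases k h' s' t' k2 st' tn'; co_close.
Qed.

Lemma co_N_hroot k v : (2 <= k <= n)%N ->
  co true k.-1 k (N k v) = r * co true k.-1 k v.
Proof.
move=> kn; have k2 : (2 <= k)%N by lia.
apply: (@scalar_ext _ _ _ _ X (fun v => co true k.-1 k (N k v))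
  (fun v => r * co true k.-1 k v)); [linear_tac|linear_tac|] => h' s' t' st' tn'.
by N_cases k h' s' t' k2 st' tn'; case: h'; co_close.
Qed.

Lemma sum_delta (f : nat -> F) a b t : (a <= t < b)%N ->
  \sum_(a <= i < b) f i * (t == i)%:R = f t.
Proof.
move=> tab; rewrite (bigD1_seq t) ?iota_uniq ?mem_index_iota //= eqxx mulr1.
by rewrite big1 ?addr0 // => i /negbTE; rewrite eq_sym => ->; rewrite mulr0.
Qed.

Lemma sum_delta0 (f : nat -> F) a b t : ~~ (a <= t < b)%N ->
  \sum_(a <= i < b) f i * (t == i)%:R = 0.
Proof.
move=> tab; rewrite big_nat big1 // => i iab.
by case: eqP => [e|_]; [rewrite e iab in tab | rewrite mulr0].
Qed.

Lemma linear_for_add (f g : cgw_space X -> F) : linear_for *%R f -> linear_for *%R g ->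
  linear_for *%R (fun v => f v + g v).
Proof. by move=> fL gL a u v; rewrite fL gL mulrDr addrACA. Qed.

Lemma linear_for_sum (s : seq nat) (f : nat -> cgw_space X -> F) :
  (forall i, linear_for *%R (f i)) ->
  linear_for *%R (fun v => \sum_(i <- s) f i v).
Proof.
move=> fL a u v; rewrite mulr_sumr -big_split /=.
by apply: eq_bigr => i _; rewrite fL.
Qed.

(** The coordinate on the root vector w_(k-1,k) is the only one of nu_k v that
involves more than two coordinates of v. *)
Lemma co_N_root k v : (2 <= k <= n)%N ->
  co false k.-1 k (N k v) = p * co false k.-1 k v
   + \sum_(k.+1 <= t < n.+1)
        m * r ^+ (t - k.+1) * (p / r * co true k t v + co false k t v)
   + \sum_(1 <= s < k.-1) p * m * r ^- (k.-2 - s) * (co true s k v + co false s k v).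
Proof.
move=> kn; have k2 : (2 <= k)%N by lia.
apply: (@scalar_ext _ _ _ _ X (fun v => co false k.-1 k (N k v)) (fun v => p * co false k.-1 k v
   + \sum_(k.+1 <= t < n.+1)
        m * r ^+ (t - k.+1) * (p / r * co true k t v + co false k t v)
   + \sum_(1 <= s < k.-1) p * m * r ^- (k.-2 - s) * (co true s k v + co false s k v))).
- by linear_tac.
- apply: linear_for_add; first apply: linear_for_add; first by linear_tac.
    by apply: linear_for_sum => t; linear_tac.
  by apply: linear_for_sum => s; linear_tac.
move=> h' s' t' st' tn'.
have S1 : \sum_(k.+1 <= t < n.+1)
   m * r ^+ (t - k.+1) * (p / r * co true k t (W h' s' t') + co false k t (W h' s' t'))
   = if (s' == k) && (k < t')%N then m * r ^+ (t' - k.+1) * (if h' then p / r else 1) else 0.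
  transitivity (\sum_(k.+1 <= t < n.+1) (m * r ^+ (t - k.+1) *
    ((if h' then p / r else 1) * (s' == k)%:R)) * (t' == t)%:R).
    apply: eq_big_nat => t tk; rewrite !cgw_co_w; try lia.
    by case: h' => /=; case: (s' == k) => /=; ring.
  case: ltnP => kt; last by rewrite andbF sum_delta0 //; lia.
  by rewrite sum_delta ?andbT; [case: (s' == k) => /=; ring | lia].
have S2 : \sum_(1 <= s < k.-1) p * m * r ^- (k.-2 - s) *
     (co true s k (W h' s' t') + co false s k (W h' s' t'))
   = if (s' < k.-1)%N && (t' == k) then p * m * r ^- (k.-2 - s') else 0.
  transitivity (\sum_(1 <= s < k.-1) (p * m * r ^- (k.-2 - s) *
     (t' == k)%:R) * (s' == s)%:R).
    apply: eq_big_nat => s sk; rewrite !cgw_co_w; try lia.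
    by case: h' {S1} => /=; case: (s' == s); case: (t' == k) => /=; ring.
  case: ltnP => ks; last by rewrite sum_delta0 //; lia.
  by rewrite sum_delta; [case: (t' == k) => /=; ring | lia].
rewrite S1 S2; clear S1 S2.
have [st1 st2] := andP st'.
N_cases k h' s' t' k2 st' tn'; rewrite ?(coD, coN, coZ) ?cgw_co_w; try lia; natcond; case: h';
  repeat (case: ltnP => //= ?; try lia).
all: rewrite ?(andbF, andbT, mulr0, mulr1, subr0, addr0, sub0r, add0r, oppr0) //=.
all: ring.
Qed.

(** The operator nu_k^2 + m nu_k - 1 has rank at most one. *)
Lemma N_quadratic k v : (2 <= k <= n)%N ->
  exists c : F, N k (N k v) + m *: N k v - v = c *: W false k.-1 k.
Proof.
move=> kn; have k2 : (2 <= k)%N by lia.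
elim/cgw_ind: v => [|a u v [c1 e1] [c2 e2]|h i j ij jn].
- by exists 0; rewrite !linear0 scale0r ?addr0 ?oppr0 ?addr0.
- exists (a * c1 + c2); rewrite [RHS]scalerDl -[(a * c1) *: _]scalerA -e1 -e2.
  by apply: vec_ext => h i j; rewrite !(nuD, nuZ, coD, coN, coZ); ring.
N_cases k h i j k2 ij jn.
- case: h; [exists 0 | exists (p ^+ 2 + m * p - 1)].
    by rewrite !nuZ N_root //; vec_field.
  by rewrite !nuZ N_root //; vec_field.
- rewrite (@N_l _ _ _ _ _ _ _ _ _ (j - k.+1)%N); [|lia|lia|lia|lia].
  by eexists; rewrite addrNK addrC addKr.
- rewrite !(nuD, nuN, nuZ) (@N_root _ _ _ _ _ k false k.-1 k) //.
  rewrite (@N_l _ _ _ _ _ k _ k _ (j - k.+1)%N); [|lia|lia|lia|lia].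
  rewrite N_lt //; try lia.
  exists (p * ((if h then p / r else 1) * m * r ^+ (j - k.+1))).
  by vec_field.
- rewrite (@N_r _ _ _ _ _ _ _ _ _ (k.-2 - i)%N); [|lia|lia|lia|lia].
  by eexists; rewrite addrNK addrC addKr.
- rewrite !(nuD, nuN, nuZ) (@N_root _ _ _ _ _ k false k.-1 k) //.
  rewrite (@N_r _ _ _ _ _ k _ _ k (k.-2 - i)%N); [|lia|lia|lia|lia].
  rewrite N_gt //; try lia.
  exists (p * (p * m * r ^- (k.-2 - i))).
  by vec_field.
- by rewrite nuZ N_other //; exists 0; vec_field.
Qed.

End ModelCoordinates.

(** * Braid and commutation relations *)

Section Braid.
Variables (F : fieldType) (p r : F) (n : nat) (X : cgw_model p r n).
Hypothesis r0 : r != 0.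
Local Notation W := (cgw_w X).
Local Notation N := (cgw_nu X).

(** The differences of the labels are named, because they are the exponents of r
that the successive evaluations produce. *)
Lemma braid_w q h s t : (0 < q)%N -> (q.+2 <= n)%N -> (0 < s < t)%N -> (t <= n)%N ->
  N q.+1 (N q.+2 (N q.+1 (W h s t))) = N q.+2 (N q.+1 (N q.+2 (W h s t))).
Proof.
move=> q0 qn st tn.
case: (ltngtP s q) => sq.
- have [e eq] : exists e, q = (s + e).+1 by exists (q - s.+1)%N; lia.
  subst q.
  case: (ltngtP t (s + e).+1) => tq.
  + by repeat N_step 0%N; vec_field.
  + case: (ltngtP t (s + e).+2) => tq2; first by lia.
      case: (ltngtP t (s + e).+3) => tq3; first by lia.
        by repeat N_step 0%N; vec_field.
      subst t; repeat N_step e.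
      by vec_field.
    by subst t; repeat N_step e; vec_field.
  by subst t; repeat N_step e; vec_field.
- case: (ltngtP s q.+1) => sq1; first by lia.
    case: (ltngtP s q.+2) => sq2; first by lia.
      by repeat N_step 0%N; vec_field.
    have [d ed] : exists d, t = (q + d).+3 by exists (t - q.+3)%N; lia.
    by subst s t; repeat N_step d; vec_field.
  subst s; case: (eqVneq t q.+2) => tq.
    by subst t; repeat N_step 0%N; case: h; vec_field.
  have [d ed] : exists d, t = (q + d).+3 by exists (t - q.+3)%N; lia.
  by subst t; repeat N_step d; vec_field.
subst s; case: (ltngtP t q.+1) => tq; first by lia.
  case: (eqVneq t q.+2) => tq2.
    by subst t; repeat N_step 0%N; case: h; vec_field.
  have [d ed] : exists d, t = (q + d).+3 by exists (t - q.+3)%N; lia.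
  by subst t; repeat N_step d; vec_field.
by subst t; repeat N_step 0%N; case: h; vec_field.
Qed.

Lemma comm_w e h s t : (e.+4 <= n)%N -> (0 < s < t)%N -> (t <= n)%N ->
  N 2 (N e.+4 (W h s t)) = N e.+4 (N 2 (W h s t)).
Proof.
move=> jn st tn.
case: (ltngtP s 2) => s2.
- have {s2}-> : s = 1%N by lia.
  case: (ltngtP t 2) => t2; first by lia.
    case: (ltngtP t e.+3) => t3.
    + by repeat N_step 0%N; vec_field.
    + case: (ltngtP t e.+4) => t4; first by lia.
        by repeat N_step 0%N; vec_field.
      by subst t; repeat N_step e; vec_field.
    by subst t; repeat N_step e; vec_field.
  by subst t; repeat N_step 0%N; case: h; vec_field.
- case: (ltngtP s e.+3) => s3.
  + case: (ltngtP t e.+3) => t3.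
    * by repeat N_step 0%N; vec_field.
    * case: (ltngtP t e.+4) => t4; first by lia.
        by repeat N_step 0%N; vec_field.
      have [f ef] : exists f, (f + s)%N = e.+2 by exists (e.+2 - s)%N; lia.
      by subst t; repeat N_step f; vec_field.
    by subst t; repeat N_step 0%N; vec_field.
  + case: (ltngtP s e.+4) => s4; first by lia.
      by repeat N_step 0%N; vec_field.
    have [f ef] : exists f, (f + e.+4.+1)%N = t by exists (t - e.+4.+1)%N; lia.
    by subst s; repeat N_step f; vec_field.
  subst s; case: (eqVneq t e.+4) => t4.
    by subst t; repeat N_step 0%N; case: h; vec_field.
  by repeat N_step 0%N; vec_field.
subst s; case: (ltngtP t e.+3) => t3.
- have [f ef] : exists f, (f + 3)%N = t by exists (t - 3)%N; lia.
  by repeat N_step f; vec_field.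
- have [f ef] : exists f, (f + 3)%N = t by exists (t - 3)%N; lia.
  case: (ltngtP t e.+4) => t4; first by lia.
    by repeat N_step f; vec_field.
  by subst t; repeat N_step e; vec_field.
by subst t; repeat N_step e; vec_field.
Qed.

Lemma N_braid k v : (2 <= k < n)%N ->
  N k (N k.+1 (N k v)) = N k.+1 (N k (N k.+1 v)).
Proof.
move=> kn; have -> : k = k.-1.+1 by lia.
have {kn} [] : (0 < k.-1)%N /\ (k.-1.+2 <= n)%N by lia.
move: (k.-1) => q q0 qn.
apply: (@lin_ext _ _ _ _ X (N q.+1 \o (N q.+2 \o N q.+1)) (N q.+2 \o (N q.+1 \o N q.+2))).
by move=> h s t st tn; apply: braid_w.
Qed.

Lemma N_comm k v : (4 <= k <= n)%N -> N 2 (N k v) = N k (N 2 v).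
Proof.
move=> kn; have -> : k = (k - 4).+4 by lia.
have {kn} : ((k - 4).+4 <= n)%N by lia.
move: (k - 4)%N => e en.
apply: (@lin_ext _ _ _ _ X (N 2 \o N e.+4) (N e.+4 \o N 2)).
by move=> h s t st tn; apply: comm_w.
Qed.

End Braid.

(** * Proper invariant subspaces are Hecke modules *)

Section Invariant.
Variables (F : fieldType) (p r : F) (n : nat) (X : cgw_model p r n).
Hypothesis r0 : r != 0.
Local Notation m := (r^-1 - r).
Local Notation W := (cgw_w X).
Local Notation N := (cgw_nu X).

Variable U : {vspace cgw_space X}.
Hypothesis Uinv : forall k v, (1 <= k <= n)%N -> v \in U -> N k v \in U.

Lemma full_of_basis :
  (forall h i j, (0 < i < j)%N -> (j <= n)%N -> W h i j \in U) -> U = fullv.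
Proof.
move=> H; apply/eqP; rewrite eqEsubv subvf /=; apply/subvP => v _.
elim/cgw_ind: v => [|a u v uU vU|h i j ij jn]; [exact: rpred0 | | exact: H].
by rewrite rpredD // rpredZ.
Qed.

Lemma root_up k : (2 <= k < n)%N -> W false k.-1 k \in U -> W false k k.+1 \in U.
Proof.
move=> kn /(Uinv (k := k.+1)); rewrite (@N_gt _ _ _ _ _ k.+1); [|lia|lia|lia].
move/(_ _)/Uinv => H; have := H k; rewrite N_lt; [|lia|lia|lia].
by apply; lia.
Qed.

(** The vector nu_(k+1) (nu_k + m) w_(k,k+1) equals w_(k-1,k) up to a multiple of
w_(k,k+1). *)
Lemma root_down k : (2 <= k < n)%N -> W false k k.+1 \in U -> W false k.-1 k \in U.
Proof.
move=> kn aU.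
have kU : N k (W false k k.+1) \in U by apply: Uinv => //; lia.
have yU : N k (W false k k.+1) + m *: W false k k.+1 \in U by rewrite rpredD // rpredZ.
have zU : N k.+1 (N k (W false k k.+1) + m *: W false k k.+1) \in U by apply: Uinv => //; lia.
suff E : N k.+1 (N k (W false k k.+1) + m *: W false k k.+1) =
    W false k.-1 k + (m * p) *: W false k k.+1.
  by move: zU; rewrite E rpredDr // rpredZ.
by rewrite ?(nuD, nuZ); repeat N_step 0%N; vec_field.
Qed.

Lemma roots_mem k : (2 <= k <= n)%N -> W false k.-1 k \in U ->
  forall j, (2 <= j <= n)%N -> W false j.-1 j \in U.
Proof.
move=> kn kU.
have up d : (k + d <= n)%N -> W false (k + d).-1 (k + d) \in U.
  elim: d => [|d IH] dn; first by rewrite addn0.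
  by rewrite addnS /=; apply: root_up; [lia | apply: IH; lia].
have down d : (2 <= k - d)%N -> W false (k - d).-1 (k - d) \in U.
  elim: d => [|d IH] dk; first by rewrite subn0.
  apply: root_down; first by lia.
  have -> : (k - d.+1).+1 = (k - d)%N by lia.
  have -> : (k - d.+1)%N = (k - d).-1 by lia.
  by apply: IH; lia.
move=> j jn; case: (leqP k j) => kj.
  by rewrite -(subnKC kj); apply: up; lia.
have -> : j = (k - (k - j))%N by lia.
by apply: down; lia.
Qed.

Lemma full_of_root k : (3 <= n)%N -> (2 <= k <= n)%N -> W false k.-1 k \in U -> U = fullv.
Proof.
move=> n3 kn /(roots_mem kn) rU.
have plain i j : (0 < i < j)%N -> (j <= n)%N -> W false i j \in U.
  elim: j => [|j IH] ij jn; first by lia.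
  case: (eqVneq i j) => [->|ne]; first by apply: (rU j.+1); lia.
  rewrite -(@N_gt _ _ _ _ X j.+1 false i j); [|lia|lia|lia].
  by apply: Uinv; [lia | apply: IH; lia].
have h2 j : (3 <= j <= n)%N -> W true 1 j + (m * r ^+ (j - 3)) *: W true 1 2 \in U.
  move=> jn; have w2 : W false 2 j \in U by apply: plain; lia.
  have : N 1 (W false 2 j) \in U by apply: Uinv => //; lia.
  by rewrite N1_w2 // rpredBr // rpredZ.
have h12 : W true 1 2 \in U.
  have w23 : W false 2 3 \in U by apply: plain; lia.
  (* The two multiples of hatted w_13 cancel. *)
  have : N 3 (W true 1 3 + (m * r ^+ (3 - 3)) *: W true 1 2) \in U.
    by apply: Uinv; [lia | apply: h2; lia].
  have -> : N 3 (W true 1 3 + (m * r ^+ (3 - 3)) *: W true 1 2) =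
      W true 1 2 + (p * m) *: W false 2 3.
    by rewrite ?(nuD, nuZ); repeat N_step 0%N; vec_field.
  by rewrite rpredDr // rpredZ.
have h1 j : (3 <= j <= n)%N -> W true 1 j \in U.
  by move=> jn; have := h2 j jn; rewrite rpredDr // rpredZ.
have hat j i : (0 < i < j)%N -> (j <= n)%N -> W true i j \in U.
  elim: i => [|i IH] ij jn; first by lia.
  case: (posnP i) => [->|i0].
    by case: (eqVneq j 2) => [->//|j2]; apply: h1; lia.
  rewrite -(@N_lt _ _ _ _ X i.+1 true i j) //=; [|lia].
  by apply: Uinv; [lia | apply: IH; lia].
by apply: full_of_basis => -[] i j ij jn; [apply: hat | apply: plain].
Qed.

(** Otherwise U would contain the root vector w_(k-1,k), on whose line the image of
nu_k^2 + m nu_k - 1 lies. *)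
Lemma hecke_on k v : (3 <= n)%N -> U <> fullv -> (2 <= k <= n)%N -> v \in U ->
  N k (N k v) = v - m *: N k v.
Proof.
move=> n3 Upr kn vU.
have [c E] := N_quadratic (X := X) r0 v kn.
have kn1 : (1 <= k <= n)%N by lia.
have cU : c *: W false k.-1 k \in U.
  by rewrite -E !(rpredB, rpredD, rpredZ, Uinv).
case: (eqVneq c 0) => [c0|c0].
  move: E; rewrite c0 scale0r => /eqP; rewrite subr_eq0 => /eqP E.
  by apply/eqP; rewrite eq_sym subr_eq E.
case: Upr; apply: (full_of_root n3 kn).
by rewrite -[W _ _ _](scalerK c0) rpredZ.
Qed.

End Invariant.

(** * Dimension bounds *)

Section LinearAlgebra.
Variables (F : fieldType) (V1 : vectType F).

Lemma dim_scalar_le1 (f : {scalar V1}) (A : {vspace V1}) :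
  (forall v, v \in A -> f v = 0 -> v = 0) -> (\dim A <= 1)%N.
Proof.
move=> finj; pose g : 'Hom(V1, F^o) := linfun (f : V1 -> F^o).
have gE v : g v = f v by rewrite lfunE.
rewrite -(limg_ker_dim g A).
have -> : (A :&: lker g)%VS = 0%VS.
  apply/eqP; rewrite -subv0; apply/subvP => v; rewrite memv_cap memv_ker gE memv0.
  by case/andP => vA /eqP fv; apply/eqP; apply: finj.
by rewrite dimv0 add0n (leq_trans (dimvS (subvf _))) // dimvf.
Qed.

Lemma dim_scalar_ker (f : {scalar V1}) (A : {vspace V1}) :
  exists B : {vspace V1}, [/\ (B <= A)%VS, forall v, v \in B -> f v = 0 &
    (\dim A <= \dim B + 1)%N].
Proof.
pose g : 'Hom(V1, F^o) := linfun (f : V1 -> F^o).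
have gE v : g v = f v by rewrite lfunE.
exists (A :&: lker g)%VS; split; first exact: capvSl.
  by move=> v; rewrite memv_cap memv_ker gE => /andP[_ /eqP].
rewrite -(limg_ker_dim g A) leq_add2l.
by rewrite (leq_trans (dimvS (subvf _))) // dimvf.
Qed.

Lemma dim_ker_le1 (g : 'End(V1)) (A B : {vspace V1}) : (B <= A)%VS -> (\dim (g @: A) <= 1)%N ->
  exists C : {vspace V1}, [/\ (C <= B)%VS, forall v, v \in C -> g v = 0 &
    (\dim B <= \dim C + 1)%N].
Proof.
move=> BA gA; exists (B :&: lker g)%VS; split; first exact: capvSl.
  by move=> v; rewrite memv_cap memv_ker => /andP[_ /eqP].
rewrite -(limg_ker_dim g B) leq_add2l.
by rewrite (leq_trans (dimvS _) gA) // limgS.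
Qed.

End LinearAlgebra.

(** * Eigenvectors of nu_2 that nu_4, ..., nu_n multiply by r *)

Section SmallRank.
Variables (F : fieldType) (p r : F) (n : nat) (X : cgw_model p r n).
Hypothesis r0 : r != 0.
Local Notation m := (r^-1 - r).
Local Notation N := (cgw_nu X).
Local Notation co := (cgw_co X).

Hypothesis r2N1 : r ^+ 2 != -1.

Lemma rDV_neq0 : r + r^-1 != 0.
Proof.
apply: contraNneq r2N1 => /(congr1 (fun x => r * x)).
by rewrite mulrDr mulr0 divff // -expr2 => /eqP; rewrite addr_eq0.
Qed.

(** Coordinates on which an operator acts by r vanish on its (-1/r)-eigenvectors. *)
Lemma eigenvalue_clash x : r * x = - (r^-1 * x) -> x = 0.
Proof.
move=> /eqP; rewrite -subr_eq0 opprK -mulrDl mulf_eq0 (negbTE rDV_neq0) /=.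
by move/eqP.
Qed.

Lemma geometric_sum N0 : m * (\sum_(0 <= i < N0) r ^+ (2 * i)) = r^-1 * (1 - r ^+ (2 * N0)).
Proof.
elim: N0 => [|N0 IH]; first by rewrite big_nil mulr0 muln0 expr0 subrr mulr0.
rewrite big_nat_recr //= mulrDr IH mulnS exprD; field.
exact: r0.
Qed.

Section Eigenvector.
Variable u : cgw_space X.
Hypothesis n6 : (6 <= n)%N.
Hypothesis u2 : N 2 u = - (r^-1 *: u).
Hypothesis uk : forall k, (4 <= k <= n)%N -> N k u = r *: u.
Let a := co false 1 3 u.
Let b := co true 1 3 u.
Let x := co false 1 2 u.

Lemma eig_high h i j : (3 <= i < j)%N -> (j <= n)%N -> co h i j u = 0.
Proof.
move=> ij jn; apply: eigenvalue_clash; rewrite -(@co_N_other _ _ _ _ X r0 2); try lia.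
by rewrite u2 coN coZ.
Qed.

Lemma eig_h12 : co true 1 2 u = 0.
Proof.
apply: eigenvalue_clash; rewrite -(@co_N_hroot _ _ _ _ X r0 2); try lia.
by rewrite u2 coN coZ.
Qed.

Lemma eig_2 h t : (3 <= t <= n)%N -> co h 2 t u = - (r^-1 * co h 1 t u).
Proof. by move=> tn; rewrite -(@co_N_lt _ _ _ _ X r0 2) ?u2 ?coN ?coZ //=; lia. Qed.

Lemma eig_1 h d : (d + 3 <= n)%N -> co h 1 (d + 3) u = r ^+ d * co h 1 3 u.
Proof.
elim: d => [|d IH] dn; first by rewrite mul1r.
rewrite addSn exprS -mulrA -IH; last lia.
rewrite -(@co_N_gt _ _ _ _ X r0 (d + 3).+1) /=; try lia.
by rewrite uk ?coZ //; lia.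
Qed.

(** Such an eigenvector is determined by its coordinates a, b and x. *)
Lemma eig_0 : a = 0 -> b = 0 -> x = 0 -> u = 0.
Proof.
rewrite /a /b /x => a0 b0 x0.
have row1 h t : (3 <= t <= n)%N -> co h 1 t u = 0.
  move=> tn; have -> : t = (t - 3 + 3)%N by lia.
  by rewrite eig_1; [case: h; rewrite ?a0 ?b0 mulr0 | lia].
apply: cgw_ext => h i j ij jn; rewrite linear0.
case: (leqP 3 i) => i3; first by apply: eig_high; lia.
case: (eqVneq j 2) => [j2|j2].
  by subst j; have -> : i = 1%N; [lia | case: h; rewrite ?x0 ?eig_h12].
case: (eqVneq i 1%N) => [->|i1]; first by apply: row1; lia.
have -> : i = 2%N by lia.
by rewrite eig_2 ?row1 ?mulr0 ?oppr0 //; lia.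
Qed.

(** The coordinate of nu_2 u = - u / r on w_12; the geometric series comes from the
labels (2, t), 3 <= t <= n. *)
Lemma eig_root2 : x * (p + r^-1) = (p * b + r * a) * r ^- 3 * (1 - r ^+ (2 * (n - 2))).
Proof.
have := @co_N_root _ _ _ _ X r0 2 u ltac:(lia); rewrite u2 coN coZ /=.
rewrite [X in _ + X]big_geq // addr0 -/x.
have -> : \sum_(3 <= t < n.+1) m * r ^+ (t - 3) * (p / r * co true 2 t u + co false 2 t u)
   = - (r^-1 * (p / r * b + a)) * (m * \sum_(0 <= i < n - 2) r ^+ (2 * i)).
  have -> : (n - 2 = n.+1 - 3)%N by lia.
  rewrite mulr_sumr mulr_sumr -{1}[3%N]add0n big_addn.
  apply: eq_big_nat => i iN; rewrite !eig_2 ?eig_1; try lia.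
  by rewrite addnK mulnC exprM expr2 -/a -/b; ring.
rewrite geometric_sum => E.
have -> : x * (p + r^-1) = p * x - (- (r^-1 * x)) by ring.
by rewrite E; field; exact: r0.
Qed.

(** The vector z = (nu_2 - r) nu_3 u has coordinate - r^2 (r a) on w_14, and its
coordinate on w_13 involves a, b and x. *)
Lemma eig_root3 : N 4 (N 2 (N 3 u) - r *: N 3 u) = r *: (N 2 (N 3 u) - r *: N 3 u) ->
  r * x = p * (m * (a + b) - a / r) + a.
Proof.
move/(congr1 (co false 1 3)).
rewrite (@co_N_gt _ _ _ _ X r0 4) //=; last lia.
rewrite coZ !coD !coN !coZ !(@co_N_lt _ _ _ _ X r0 2) //=; try lia.
rewrite (@co_N_lt _ _ _ _ X r0 3) //=; try lia.
rewrite (@co_N_other _ _ _ _ X r0 3) //; try lia.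
rewrite (@co_N_r _ _ _ _ X r0 3 false 1) //; try lia.
rewrite (@co_N_root _ _ _ _ X r0 3) //; try lia.
rewrite big_nat big1 => [|t tn]; last by rewrite !eig_high ?mulr0 ?addr0 ?mulr0 //; lia.
rewrite big_nat1 /= eig_high; try lia.
rewrite eig_2; last lia.
rewrite (@eig_1 false 1) //; last lia.
rewrite -/a -/b -/x subnn expr0 expr1 invr1 mulr1 => E.
apply: (mulfI r0).
have -> : r * (r * x) = p * (m * (a + b) - a / r) * r + (r * m) * (r * a)
  - r * (p * - (r^-1 * a) + 0 + p * m * (b + a) - r * (x - m * a)) by ring.
by rewrite -E; field; exact: r0.
Qed.

End Eigenvector.

End SmallRank.

(** * Dimension bound in the absence of polytabloids *)

Section SmallDim.
Variables (F : fieldType) (p r : F) (n : nat) (X : cgw_model p r n).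
Hypothesis r0 : r != 0.
Local Notation m := (r^-1 - r).
Local Notation N := (cgw_nu X).
Local Notation co := (cgw_co X).

Hypothesis n6 : (6 <= n)%N.
Hypothesis p0 : p != 0.
Hypothesis r2N1 : r ^+ 2 != -1.
Hypothesis q1 : r ^+ (2 * (n - 2)) != 1.
Hypothesis q2 : r ^+ (2 * (n - 4)) != 1.
Variable U : {vspace cgw_space X}.
Hypothesis Uinv : forall k v, (1 <= k <= n)%N -> v \in U -> N k v \in U.
Hypothesis Uproper : U <> fullv.
Hypothesis noA : forall v, v \in U -> N 2 v = - (r^-1 *: v) -> N 4 v = - (r^-1 *: v) -> v = 0.

Let hecke k v : (2 <= k <= n)%N -> v \in U -> N k (N k v) = v - m *: N k v.
Proof. by move=> kn vU; apply: hecke_on kn vU; try lia. Qed.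

Lemma image_eigenvector k v : (2 <= k <= n)%N -> v \in U ->
  N k (N k v - r *: v) = - (r^-1 *: (N k v - r *: v)).
Proof. by move=> kn vU; rewrite !(nuD, nuN, nuZ) hecke //; vec_field. Qed.

(** For k = 4 the vector (nu_4 - r) u is a (-1/r)-eigenvector of both nu_2 and
nu_4, hence 0. The braid relation between nu_k and nu_(k+1), applied to u,
passes the property from k to k + 1. *)
Lemma eig2_inv k u : (4 <= k <= n)%N -> u \in U -> N 2 u = - (r^-1 *: u) ->
  N k u = r *: u.
Proof.
elim: k u => [|k IH] u; first by lia.
move=> kn uU u2; have [k3|k4] : k = 3 \/ (4 <= k <= n)%N by lia.
  subst k; apply/eqP; rewrite -subr_eq0; apply/eqP; apply: noA.
  - by rewrite rpredB ?rpredZ ?Uinv //; lia.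
  - by rewrite nuD nuN nuZ (@N_comm _ _ _ _ X) // u2 nuN nuZ; vec_field.
  - by rewrite image_eigenvector //; lia.
have wU : N k.+1 u \in U by apply: Uinv => //; lia.
have w2 : N 2 (N k.+1 u) = - (r^-1 *: N k.+1 u).
  by rewrite (@N_comm _ _ _ _ X) // u2 nuN nuZ.
have wk := IH _ k4 wU w2.
have uk := IH _ k4 uU u2.
have B : r *: (r *: N k.+1 u) = r *: N k.+1 (N k.+1 u).
  by have := @N_braid _ _ _ _ X r0 k u ltac:(lia); rewrite uk !nuZ wk nuZ.
move/(congr1 (fun x => r^-1 *: x)): B; rewrite !scalerA !mulrA mulVf // mul1r scale1r.
rewrite hecke //; last lia.
move=> /(congr1 (fun x => r *: (x + m *: N k.+1 u))); rewrite addrNK => <-.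
by vec_field.
Qed.

(** The (-1/r)-eigenspace of nu_2 in U has dimension at most one: one of the two
coordinates a, b determines its vectors. *)
Lemma eig2_scalar : exists f : {scalar cgw_space X},
  forall u, u \in U -> N 2 u = - (r^-1 *: u) -> f u = 0 -> u = 0.
Proof.
pose A := r ^- 2 * (1 - r ^+ (2 * (n - 2))).
pose cb := p * (A - (p + r^-1) * m).
pose ca := r * A - (p + r^-1) * (p * m - p / r + 1).
have rel u : u \in U -> N 2 u = - (r^-1 *: u) ->
    [/\ ca * co false 1 3 u + cb * co true 1 3 u = 0,
      r * co false 1 2 u = p * (m * (co false 1 3 u + co true 1 3 u) - co false 1 3 u / r)
        + co false 1 3 u &
      co false 1 3 u = 0 -> co true 1 3 u = 0 -> co false 1 2 u = 0 -> u = 0].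
  move=> uU u2; have uk k : (4 <= k <= n)%N -> N k u = r *: u by move=> kn; apply: eig2_inv.
  have e2 := eig_root2 r0 r2N1 n6 u2 uk.
  have e3 : r * co false 1 2 u =
      p * (m * (co false 1 3 u + co true 1 3 u) - co false 1 3 u / r) + co false 1 3 u.
    apply: (eig_root3 r0 r2N1 n6 u2 uk).
    have vU : N 3 u \in U by apply: Uinv => //; lia.
    apply: eig2_inv; [lia | rewrite rpredB ?rpredZ ?Uinv //; lia |].
    by apply: image_eigenvector => //; lia.
  split=> //; last exact: (eig_0 r0 r2N1 n6 u2 uk).
  have : r * co false 1 2 u * (p + r^-1) =
    r * ((p * co true 1 3 u + r * co false 1 3 u) * r ^- 3 * (1 - r ^+ (2 * (n - 2)))).
    by rewrite -e2; ring.
  rewrite e3 => /eqP; rewrite -subr_eq0 => /eqP E.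
  rewrite -[RHS]oppr0 -[in RHS]E /ca /cb /A; field.
  exact: r0.
(* Eliminating x from the two relations gives ca * a + cb * b = 0. *)
case: (eqVneq cb 0) => [cb0|cb0]; last first.
  exists (co false 1 3) => u uU u2 a0; have [E1 E2 E3] := rel u uU u2.
  move: E1; rewrite a0 mulr0 add0r => /eqP; rewrite mulf_eq0 (negbTE cb0) /= => /eqP b0.
  apply: E3 => //; move: E2; rewrite a0 b0 !(mul0r, mulr0, addr0, subr0) => /eqP.
  by rewrite mulf_eq0 (negbTE r0) /= => /eqP.
(* ca = cb = 0 forces p = - 1/r or p = r, and then r^(2(n-2)) = 1 or
   r^(2(n-4)) = 1. *)
have ca0 : ca != 0.
  apply/eqP => ca0.
  have A0 : A = (p + r^-1) * m.
    by apply/eqP; rewrite -subr_eq0; move/eqP: cb0; rewrite mulf_eq0 (negbTE p0).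
  have : (p + r^-1) * (p - r) = 0.
    by rewrite -[RHS](mulr0 r^-1) -[in RHS]ca0 /ca A0; field; exact: r0.
  have r2 : r ^+ 2 != 0 by rewrite expf_neq0.
  move/eqP; rewrite mulf_eq0 => /orP[] /eqP pr.
    move: A0; rewrite pr mul0r /A => /eqP; rewrite mulf_eq0 invr_eq0 (negbTE r2) /=.
    by rewrite subr_eq0 eq_sym (negbTE q1).
  have pE : p = r by apply/eqP; rewrite -subr_eq0 pr.
  have : 1 - r ^+ (2 * (n - 2)) = 1 - r ^+ 4.
    by rewrite -[LHS](mulVKf r2) -/A A0 pE; field; exact: r0.
  have -> : (2 * (n - 2) = 4 + 2 * (n - 4))%N by lia.
  move/addrI/oppr_inj; rewrite exprD -[RHS]mulr1 => /(mulfI (expf_neq0 4 r0)) /eqP.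
  by rewrite (negbTE q2).
exists (co true 1 3) => u uU u2 b0; have [E1 E2 E3] := rel u uU u2.
move: E1; rewrite b0 mulr0 addr0 => /eqP; rewrite mulf_eq0 (negbTE ca0) /= => /eqP a0.
apply: E3 => //; move: E2; rewrite a0 b0 !(mul0r, mulr0, addr0, subr0) => /eqP.
by rewrite mulf_eq0 (negbTE r0) /= => /eqP.
Qed.

Lemma inj_N k v : (2 <= k <= n)%N -> v \in U -> N k v = 0 -> v = 0.
Proof.
by move=> kn vU v0; have := hecke kn vU; rewrite v0 linear0 scaler0 subr0.
Qed.

Lemma img_N k : (2 <= k <= n)%N -> (N k @: U = U)%VS.
Proof.
move=> kn; apply/eqP; rewrite eqEdim; apply/andP; split.
  by apply/subvP => _ /memv_imgP [v vU ->]; apply: Uinv => //; lia.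
rewrite -{1}(limg_ker_dim (N k) U) (_ : (U :&: lker (N k))%VS = 0%VS) ?dimv0 //.
apply/eqP; rewrite -subv0; apply/subvP => v; rewrite memv_cap memv_ker memv0.
by case/andP => vU /eqP /(inj_N kn vU) ->.
Qed.

Let T k : 'End(cgw_space X) := (N k - r *: \1)%VF.
Let TE k v : T k v = N k v - r *: v.
Proof. by rewrite /T !lfun_simp. Qed.

(** The operator nu_k nu_(k+1) maps U onto itself and conjugates nu_k into
nu_(k+1). *)
Lemma rank_N k : (2 <= k <= n)%N -> (\dim (T k @: U) <= 1)%N.
Proof.
elim: k => [|k IH] kn; first by lia.
have [k1|k2] : k = 1 \/ (2 <= k < n)%N by lia.
  have [f fP] := eig2_scalar.
  subst k; apply: (dim_scalar_le1 (f := f)) => _ /memv_imgP [v vU ->].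
  rewrite TE; apply: fP; first by rewrite rpredB ?rpredZ ?Uinv //; lia.
  by apply: image_eigenvector => //; lia.
have {}IH := IH ltac:(lia).
apply: leq_trans IH.
have -> : (T k.+1 @: U = T k.+1 @: (N k @: (N k.+1 @: U)))%VS.
  by rewrite !img_N //; lia.
have -> : (T k.+1 @: (N k @: (N k.+1 @: U)) = N k @: (N k.+1 @: (T k @: U)))%VS.
  rewrite -!limg_comp; congr (_ @: U)%VS; apply/lfunP => v.
  rewrite !comp_lfunE !TE !(nuD, nuN, nuZ) N_braid //.
have img_le (f : 'End(cgw_space X)) B : (\dim (f @: B) <= \dim B)%N.
  by rewrite -(limg_ker_dim f B) leq_addl.
by rewrite (leq_trans (img_le _ _)).
Qed.

Lemma common_eig_0 v : (forall k, (2 <= k <= n)%N -> N k v = r *: v) ->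
  (forall h, co h 1 2 v = 0) -> v = 0.
Proof.
move=> rv v12.
have v1 h d : (d.+2 <= n)%N -> co h 1 d.+2 v = 0.
  elim: d => [|d IH] dn; first exact: v12.
  have := @co_N_gt _ _ _ _ X r0 d.+3 h 1 v ltac:(lia) ltac:(lia).
  by rewrite rv ?coZ; [move <-; rewrite /= IH ?mulr0 //; lia | lia].
have vi h d t : (d.+1 < t <= n)%N -> co h d.+1 t v = 0.
  elim: d => [|d IH] dt; first by case: t dt => [|[|t]] dt; [lia | lia | apply: v1; lia].
  have := @co_N_lt _ _ _ _ X r0 d.+2 h t v ltac:(lia) ltac:(lia).
  by rewrite rv ?coZ; [move <-; rewrite /= IH ?mulr0 //; lia | lia].
apply: cgw_ext => h i j ij jn; rewrite linear0.
by case: i ij => [|i] ij; [lia | apply: vi; lia].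
Qed.

Lemma dim_le_succ : (\dim U <= n.+1)%N.
Proof.
have H j : (1 <= j <= n)%N -> exists C : {vspace cgw_space X}, [/\ (C <= U)%VS,
    forall v k, v \in C -> (2 <= k <= j)%N -> N k v = r *: v & (\dim U <= \dim C + j.-1)%N].
  elim: j => [|j IH] jn; first by lia.
  have [j0|j1] : j = 0%N \/ (1 <= j <= n)%N by lia.
    by exists U; split=> [//|v k _|]; rewrite ?j0 ?addn0 //; lia.
  have [B [BU BN Bd]] := IH j1.
  have [|C [CB CN Cd]] := dim_ker_le1 BU (rank_N (k := j.+1) _); first by lia.
  exists C; split=> [|v k vC kj|]; first exact: subv_trans BU.
    case: (eqVneq k j.+1) => [->|kne]; last by apply: BN; [apply: (subvP CB) | lia].
    by apply/eqP; rewrite -subr_eq0 -TE CN.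
  by lia.
have [|C [CU CN Cd]] := H n; first by lia.
have [C1 [C1C C1N C1d]] := dim_scalar_ker (co false 1 2) C.
have [C2 [C2C C2N C2d]] := dim_scalar_ker (co true 1 2) C1.
have C0 v : v \in C2 -> v = 0.
  move=> vC2; have vC1 := subvP C2C _ vC2; have vC := subvP C1C _ vC1.
  by apply: common_eig_0 => [k kn|[]]; [apply: CN | apply: C2N | apply: C1N].
have C20 : C2 = 0%VS by apply/eqP; rewrite -subv0; apply/subvP => v /C0 ->; rewrite memv0.
rewrite C20 dimv0 in C2d; lia.
Qed.

End SmallDim.

(** * Polytabloids *)

Section Polytabloids.
Variables (F : fieldType) (p r : F) (n : nat) (X : cgw_model p r n).
Hypothesis r0 : r != 0.
Local Notation m := (r^-1 - r).
Local Notation W := (cgw_w X).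
Local Notation N := (cgw_nu X).

Variables (a b : F).

(** The quantum polytabloid on (i, i+1 ; j, j+1), in plain or hatted vectors. *)
Definition pol h i j : cgw_space X :=
  W h i j - r^-1 *: W h i.+1 j - r^-1 *: W h i j.+1 + r ^- 2 *: W h i.+1 j.+1.

(** The combination of the two polytabloids with weights a (plain) and b (hatted). *)
Definition polab i j : cgw_space X := a *: pol false i j + b *: pol true i j.

Lemma polab_r i j : (0 < i)%N -> (i.+1 < j)%N -> (j.+2 <= n)%N ->
  N j.+1 (N j.+2 (polab i j)) = r *: polab i j.+1.
Proof.
move=> i0 ij jn; rewrite /polab /pol ?(nuD, nuN, nuZ); repeat N_step 0%N.
by vec_field.
Qed.

Lemma polab_l i j : (0 < i)%N -> (i.+2 < j)%N -> (j.+1 <= n)%N ->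
  N i.+1 (N i.+2 (polab i j)) = r *: polab i.+1 j.
Proof.
move=> i0 ij jn; rewrite /polab /pol ?(nuD, nuN, nuZ); repeat N_step 0%N.
by vec_field.
Qed.

(** The explicit value of nu_(i+2) on the polytabloid on (i, i+1 ; i+2, i+3), in
which the label (i, i+1) occurs. *)
Definition polt i : cgw_space X :=
  a *: (W false i i.+1 - m *: W false i i.+2 - (p / r) *: W false i.+1 i.+2
        - W false i i.+3 + r ^- 2 *: W false i.+2 i.+3)
  + b *: (W true i i.+1 - m *: W true i i.+2 - W true i.+1 i.+2
        - W true i i.+3 + r ^- 2 *: W true i.+2 i.+3)
  + (p * m * (a + b)) *: W false i.+1 i.+2.

Lemma poltE i : (0 < i)%N -> (i.+3 <= n)%N -> N i.+2 (polab i i.+2) = polt i.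
Proof.
move=> i0 jn; rewrite /polab /pol /polt ?(nuD, nuN, nuZ); repeat N_step 0%N.
by vec_field.
Qed.

(** The plane of the polytabloids on (1, 2 ; 3, 4) is stable under nu_1. *)
Lemma N1_polab : (4 <= n)%N ->
  N 1 (polab 1 3) = (- (r^-1 * b) - m * a) *: pol false 1 3 - (r * a) *: pol true 1 3.
Proof.
move=> n4; rewrite /polab /pol ?(nuD, nuN, nuZ).
rewrite (N1_w1 X (j := 3)) ?(N1_w1 X (j := 4)) ?(N1_w2 X (j := 3)) ?(N1_w2 X (j := 4)); try lia.
rewrite (N1_h1 X (j := 3)) ?(N1_h1 X (j := 4)) ?(N1_h2 X (j := 3)) ?(N1_h2 X (j := 4)); try lia.
rewrite subnn (_ : 4 - 3 = 1)%N // expr0 expr1.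
by vec_field.
Qed.

End Polytabloids.

(** * Functionals on polytabloids *)

Section PolytabloidCoordinates.
Variables (F : fieldType) (p r : F) (n : nat) (X : cgw_model p r n).
Hypothesis r0 : r != 0.
Local Notation m := (r^-1 - r).
Local Notation W := (cgw_w X).
Local Notation N := (cgw_nu X).
Local Notation co := (cgw_co X).

Local Notation polab := (polab X).
Local Notation polt := (polt X).
Local Notation pol := (pol X).

(** Coordinates on labels with no index in {1, 2}, or with none in {3, 4}, vanish;
the remaining ones are proportional to those on (1, 3). *)
Lemma polab_shape v : r ^+ 2 != -1 -> (6 <= n)%N ->
  N 2 v = - (r^-1 *: v) -> N 4 v = - (r^-1 *: v) ->
  v = polab (co false 1 3 v) (co true 1 3 v) 1 3.
Proof.
move=> r2N1 n6 v2 v4.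
have z2 h i j : (3 <= i < j)%N -> (j <= n)%N -> co h i j v = 0.
  move=> ij jn; apply: (eigenvalue_clash r0 r2N1); rewrite -(@co_N_other _ _ _ _ X r0 2); try lia.
  by rewrite v2 coN coZ.
have z4 h i j : (0 < i < 3)%N -> (i < j <= n)%N -> j != 3 -> j != 4 -> co h i j v = 0.
  move=> ij jn j3 j4; apply: (eigenvalue_clash r0 r2N1).
  rewrite -(@co_N_other _ _ _ _ X r0 4); try lia.
  by rewrite v4 coN coZ.
have e2 h j : (3 <= j <= n)%N -> co h 2 j v = - (r^-1 * co h 1 j v).
  move=> jn; rewrite -(@co_N_lt _ _ _ _ X r0 2 h j v); try lia.
  by rewrite v2 coN coZ.
have e4 h : co h 1 4 v = - (r^-1 * co h 1 3 v).
  rewrite -(@co_N_gt _ _ _ _ X r0 4 h 1 v); try lia.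
  by rewrite v4 coN coZ.
apply: cgw_ext => h i j ij jn; rewrite /polab /pol !(coD, coN, coZ).
have [i3|i3] := leqP 3 i.
  by rewrite z2 ?cgw_co_w; try lia; natcond; rewrite ?(andbF, mulr0, oppr0, addr0) /= ?mulr0 ?addr0.
have [j3|j3] := eqVneq j 3%N; last have [j4|j4] := eqVneq j 4%N.
- subst j; have [->|->] : i = 1%N \/ i = 2%N by lia.
    by rewrite !cgw_co_w; try lia; case: h => /=; ring.
  by rewrite e2 ?cgw_co_w; try lia; case: h => /=; ring.
- subst j; have [->|->] : i = 1%N \/ i = 2%N by lia.
    by rewrite e4 !cgw_co_w; try lia; case: h => /=; ring.
  by rewrite e2 ?e4 ?cgw_co_w; try lia; case: h => /=; field; rewrite r0.
by rewrite z4 ?cgw_co_w; try lia; natcond; rewrite ?(andbF, mulr0, oppr0, addr0) /= ?mulr0 ?addr0.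
Qed.

Section Values.
Variables (a b : F).

Ltac label_false := repeat match goal with
  | |- context [(@eq_op _ ?x ?y) && (@eq_op _ ?z ?t)] =>
     lazymatch type of x with nat =>
       rewrite (_ : (x == y) && (z == t) = false); [|apply/negbTE/negP; lia] end
  end; rewrite ?(andbF, mulr0, oppr0, addr0, subr0).

(** The hatted coordinate of a polytabloid on (i, j) is zero unless (i, j) is its
first label or has larger sum. *)
Lemma polab_co i j i' j' : (0 < i < j)%N -> (j <= n)%N ->
  (i + j <= i' + j')%N -> co true i j (polab a b i' j') = b * ((i' == i) && (j' == j))%:R.
Proof.
move=> ij jn le; rewrite /polab /pol !(coD, coN, coZ) !cgw_co_w //=.
by label_false; ring.
Qed.

Lemma polt_co i j i' : (0 < i < j)%N -> (j <= n)%N ->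
  (i + j <= i' + i'.+1)%N -> co true i j (polt a b i') = b * ((i' == i) && (i'.+1 == j))%:R.
Proof.
move=> ij jn le; rewrite /polt !(coD, coN, coZ) !cgw_co_w //=.
by label_false; ring.
Qed.

(** This functional vanishes when the coordinates on the plain and the hatted
vector with label (i, j) are proportional to a and b. *)
Definition kappa i j v := a * co true i j v - b * co false i j v.

Lemma kappa_polab i j i' j' : (0 < i < j)%N -> (j <= n)%N -> kappa i j (polab a b i' j') = 0.
Proof.
move=> ij jn; rewrite /kappa /polab /pol !(coD, coN, coZ) !cgw_co_w //=; ring.
Qed.

(** The coordinates of [polt] on (i'+1, i'+2) are not in the ratio of a to b; the
hypothesis excludes this label. *)
Lemma kappa_polt i j i' : (0 < i)%N -> (i.+2 <= j <= n)%N -> kappa i j (polt a b i') = 0.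
Proof.
move=> i0 jn; rewrite /kappa /polt !(coD, coN, coZ) !cgw_co_w /=; try lia.
have -> : (i'.+1 == i) && (i'.+2 == j) = false by apply/negbTE/negP; lia.
by rewrite /=; ring.
Qed.

(** The r-weighted sum of the hatted coordinates. *)
Definition theta v :=
  \sum_(1 <= i < n.+1) \sum_(i.+1 <= j < n.+1) r ^+ (i + j) * co true i j v.

Lemma theta_linear : linear_for *%R theta.
Proof. by apply: linear_for_sum => i; apply: linear_for_sum => j c u v; rewrite coD coZ; ring. Qed.

Lemma theta_w h i j : (0 < i < j)%N -> (j <= n)%N ->
  theta (W h i j) = if h then r ^+ (i + j) else 0.
Proof.
move=> ij jn; rewrite /theta.
transitivity (\sum_(1 <= s < n.+1) (if h then r ^+ (i + j) else 0) * (i == s)%:R).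
  apply: eq_big_nat => s sn.
  transitivity (\sum_(s.+1 <= t < n.+1) (r ^+ (s + t) * (h && (i == s))%:R) * (j == t)%:R).
    apply: eq_big_nat => t tn; rewrite cgw_co_w; try lia.
    by case: h => /=; case: (i == s); case: (j == t) => /=; ring.
  case: eqP => [<-|_]; last by rewrite andbF !mulr0 big1 // => t _; rewrite mulr0 mul0r.
  by rewrite sum_delta; [case: h => /=; ring | lia].
by rewrite sum_delta //; lia.
Qed.

Let tD u v : theta (u + v) = theta u + theta v.
Proof. by have := theta_linear 1 u v; rewrite scale1r mul1r. Qed.
Let t0 : theta 0 = 0.
Proof. by have := theta_linear (- 1) 0 0; rewrite scaler0 addr0 mulN1r addNr. Qed.
Let tZ c u : theta (c *: u) = c * theta u.
Proof. by have := theta_linear c u 0; rewrite addr0 t0 addr0. Qed.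
Let tN u : theta (- u) = - theta u.
Proof. by rewrite -scaleN1r tZ mulN1r. Qed.

Lemma theta_polab i j : (0 < i)%N -> (i.+1 < j)%N -> (j < n)%N -> theta (polab a b i j) = 0.
Proof.
move=> i0 ij jn; rewrite /polab /pol !(tD, tN, tZ) !theta_w; try lia.
by rewrite !addSn !addnS !exprS; field; rewrite r0.
Qed.

Lemma theta_polt i : (0 < i)%N -> (i.+3 <= n)%N -> theta (polt a b i) = 0.
Proof.
move=> i0 jn; rewrite /polt !(tD, tN, tZ) !theta_w; try lia.
by rewrite !addSn !addnS !exprS; field; rewrite r0.
Qed.

Lemma N1_polt : (4 <= n)%N -> let A := p * m * (a + b) - p * a / r in
  N 1 (polt a b 1) =
   (p * b + m * A - m ^+ 2 * a / r - m * a + m ^+ 2 * (r^-1 + r) * b / r ^+ 2) *: W true 1 2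
   + (A - m ^+ 2 * a + m * b / r ^+ 3) *: W true 1 3
   + (m * (b / r ^+ 2 - a)) *: W true 1 4
   + (m * (b / r ^+ 2 - a)) *: W true 2 3
   + (m * b / r - a) *: W true 2 4
   + (b / r) *: W true 3 4
   + (r * a + m ^+ 2 * a / r + m * a - m * b - m ^+ 2 * (r^-1 + r) * b / r ^+ 2) *: W false 1 2
   + (m ^+ 2 * a - b - m * b / r ^+ 3) *: W false 1 3
   + (- (m * (b / r ^+ 2 - a))) *: W false 1 4
   + (- (m * A) - m * b / r ^+ 2) *: W false 2 3
   + (- b - m * b / r) *: W false 2 4
   + (a / r) *: W false 3 4.
Proof.
move=> n4; rewrite /polt ?(nuD, nuN, nuZ).
rewrite N1_w12 ?N1_h12 ?(N1_w X (i := 3) (j := 4)); try lia.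
rewrite (N1_w1 X (j := 3)) ?(N1_w1 X (j := 4)) ?(N1_w2 X (j := 3)); try lia.
rewrite (N1_h1 X (j := 3)) ?(N1_h1 X (j := 4)) ?(N1_h2 X (j := 3)) ?N1_h34; try lia.
rewrite subnn (_ : 4 - 3 = 1)%N // expr0 expr1.
by vec_field.
Qed.

Lemma kappa14_N1_polt : (4 <= n)%N ->
  kappa 1 4 (N 1 (polt a b 1)) = m * (b / r ^+ 2 - a) * (a + b).
Proof.
move=> n4; rewrite /kappa N1_polt // !(coD, coZ) !cgw_co_w //=.
by field; rewrite r0.
Qed.

Lemma kappa13_N1_polt : (4 <= n)%N ->
  kappa 1 3 (N 1 (polt a b 1)) =
   a * (p * m * (a + b) - p * a / r - m ^+ 2 * a + m * b / r ^+ 3)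
   - b * (- b + m ^+ 2 * a - m * b / r ^+ 3).
Proof.
move=> n4; have n3 : (3 <= n)%N by lia.
rewrite /kappa N1_polt // !(coD, coZ) !cgw_co_w //=.
by field; rewrite r0.
Qed.

Lemma theta_N1_polt : (4 <= n)%N ->
  theta (N 1 (polt a b 1)) = r ^+ 3 * (p + r ^- 3) * (b / r ^+ 2 - a).
Proof.
move=> n4; rewrite N1_polt // !(tD, tZ) !theta_w //=; try lia.
by rewrite -[(1 + 2)%N]/3%N -[(1 + 3)%N]/4%N -[(1 + 4)%N]/5%N -[(2 + 3)%N]/5%N
  -[(2 + 4)%N]/6%N -[(3 + 4)%N]/7%N; field; rewrite r0.
Qed.

End Values.

End PolytabloidCoordinates.

(** * The module generated by a polytabloid *)

Section Span.
Variables (F : fieldType) (V1 : vectType F) (L : finType) (g : L -> V1).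

Lemma family_spans (A : {vspace V1}) : (forall x, g x \in A) ->
  (forall f : L -> F, \sum_x f x *: g x = 0 -> forall x, f x = 0) ->
  \dim A = #|L| -> forall v, v \in A -> exists f : L -> F, v = \sum_x f x *: g x.
Proof.
move=> gA gfree dA v vA.
pose t := [tuple g (enum_val i) | i < #|L|].
have tE (i : 'I_#|L|) : t`_i = g (enum_val i).
  by rewrite -(tnth_nth 0) tnth_mktuple.
have sumE (f : 'I_#|L| -> F) :
    \sum_i f i *: t`_i = \sum_x f (enum_rank x) *: g x.
  rewrite (reindex (@enum_rank L)) /=; last exact/onW_bij/enum_rank_bij.
  by apply: eq_bigr => x _; rewrite tE enum_rankK.
have tbasis : basis_of A t.
  rewrite basisEfree size_tuple dA leqnn andbT; apply/andP; split.
    apply/freeP => f; rewrite sumE => /gfree H i.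
    by rewrite -(enum_valK i).
  by apply/span_subvP => _ /mapP [i _ ->]; apply: gA.
exists (fun x => coord t (enum_rank x) v).
by rewrite -(sumE (fun i => coord t i v)); apply: coord_basis tbasis vA.
Qed.

End Span.

Section PolytabloidModule.
Variables (F : fieldType) (p r : F) (n : nat) (X : cgw_model p r n).
Hypothesis r0 : r != 0.
Local Notation m := (r^-1 - r).
Local Notation N := (cgw_nu X).
Local Notation co := (cgw_co X).

Local Notation polab := (polab X).
Local Notation polt := (polt X).

Hypothesis n6 : (6 <= n)%N.
Variable U : {vspace cgw_space X}.
Hypothesis Uinv : forall k v, (1 <= k <= n)%N -> v \in U -> N k v \in U.

Section Family.
Variables (a b : F).
Hypothesis b0 : b != 0.
Hypothesis U13 : polab a b 1 3 \in U.

Lemma polab_mem i j : (0 < i)%N -> (i.+1 < j < n)%N -> polab a b i j \in U.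
Proof.
have scaleU u : r *: u \in U -> u \in U by move=> uU; rewrite -[u](scalerK r0) rpredZ.
have row1 d : (d.+3 < n)%N -> polab a b 1 d.+3 \in U.
  elim: d => [//|d IH] dn; apply: scaleU; rewrite -polab_r //.
  by do 2 (apply: Uinv; first by lia); apply: IH; lia.
elim: i j => [//|i IH] j _ ij.
case: (posnP i) => [i0|i0].
  by subst i; case: j ij => [|[|[|j]]] ij; [lia | lia | lia | apply: row1; lia].
apply: scaleU; rewrite -polab_l //; try lia.
by do 2 (apply: Uinv; first by lia); apply: IH; lia.
Qed.

Lemma polt_mem i : (0 < i)%N -> (i.+3 <= n)%N -> polt a b i \in U.
Proof.
by move=> i0 jn; rewrite -poltE //; apply: Uinv; [lia | apply: polab_mem; lia].
Qed.

(** The leading labels: the pairs (i, j) with 1 <= i < j <= n - 1 and i <= n - 3,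
encoded by (i - 1, j - 1). *)
Definition lead : finType := {j : 'I_(n - 1) & 'I_(minn j (n - 3))}.
Definition lead_i (x : lead) : nat := (tagged x).+1.
Definition lead_j (x : lead) : nat := (tag x : nat).+1.

Lemma card_lead : #|lead| = ((n * (n - 3)) %/ 2)%N.
Proof.
rewrite card_tagged sumnE big_map big_enum /=.
transitivity (\sum_(j < n - 1) minn j (n - 3))%N.
  by apply: eq_bigr => j _; rewrite card_ord.
have [k nk] : exists k, n = k + 3 by exists (n - 3)%N; lia.
have -> : (n - 1 = k.+2)%N by lia.
have -> : (n - 3 = k)%N by lia.
rewrite big_ord_recr /= (eq_bigr (fun j : 'I_k.+1 => j : nat)); last first.
  by move=> j _; apply/minn_idPl; rewrite -ltnS.
have := bin2_sum k.+1; rewrite big_mkord => ->; rewrite bin2 /= nk.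
have -> : (minn k.+1 k = k)%N by lia.
rewrite -divn2 -[X in (_ + X)%N](mulnK k (ltn0Sn 1)) -divnDr ?dvdn_mull //.
by congr (_ %/ _)%N; lia.
Qed.

Lemma leadP x : [/\ (0 < lead_i x)%N, (lead_i x < lead_j x)%N, (lead_j x < n)%N &
  (lead_i x + 3 <= n)%N].
Proof.
have := ltn_ord (tagged x); have := ltn_ord (tag x); rewrite /lead_i /lead_j.
by move=> h1 h2; split; lia.
Qed.

Lemma lead_inj x y : lead_i x = lead_i y -> lead_j x = lead_j y -> x = y.
Proof.
case: x y => [j i] [j' i']; rewrite /lead_i /lead_j /= => - [ei] [ej].
have e : j = j' by apply: val_inj.
by subst j'; congr Tagged; apply: val_inj.
Qed.

(** The q-analogue of the standard basis of the Specht module of shape (n-2, 2):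
one vector for each leading label. *)
Definition fam (x : lead) : cgw_space X :=
  if lead_j x == (lead_i x).+1 then polt a b (lead_i x) else polab a b (lead_i x) (lead_j x).

Lemma fam_mem x : fam x \in U.
Proof.
have [i0 ij jn i3] := leadP x.
by rewrite /fam; case: eqP => e; [apply: polt_mem | apply: polab_mem]; lia.
Qed.

Lemma fam_co x y : (lead_i x + lead_j x <= lead_i y + lead_j y)%N ->
  co true (lead_i x) (lead_j x) (fam y) = b * (y == x)%:R.
Proof.
have [i0 ij jn i3] := leadP x => le.
have -> : (y == x) = (lead_i y == lead_i x) && (lead_j y == lead_j x).
  by apply/eqP/andP => [->|[/eqP ? /eqP ?]]; [rewrite !eqxx | apply: lead_inj].
rewrite /fam; case: eqP => e; last by apply: polab_co => //; lia.
by rewrite e in le *; apply: polt_co; lia.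
Qed.

Lemma fam_free (f : lead -> F) : \sum_x f x *: fam x = 0 -> forall x, f x = 0.
Proof.
move=> f0.
suff H N0 x : (lead_i x + lead_j x < N0)%N -> f x = 0 by move=> x; apply: (H _ x (leqnn _)).
elim: N0 x => [//|N0 IH] x xN.
have := congr1 (co true (lead_i x) (lead_j x)) f0.
rewrite linear_sum linear0 (bigD1 x) //= big1 => [|y yx].
  rewrite addr0 coZ fam_co // eqxx mulr1 => /eqP.
  by rewrite mulf_eq0 (negbTE b0) orbF => /eqP.
rewrite coZ; case: (ltnP (lead_i y + lead_j y) (lead_i x + lead_j x)) => xy.
  by rewrite IH ?mul0r //; lia.
by rewrite fam_co // (negbTE yx) !mulr0.
Qed.

Hypothesis dimU : \dim U = ((n * (n - 3)) %/ 2)%N.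

(** For dimension reasons the family spans U. *)
Lemma functional_eq0 (f : cgw_space X -> F) : linear_for *%R f ->
  (forall i j, (0 < i)%N -> (i.+1 < j < n)%N -> f (polab a b i j) = 0) ->
  (forall i, (0 < i)%N -> (i.+3 <= n)%N -> f (polt a b i) = 0) ->
  forall v, v \in U -> f v = 0.
Proof.
move=> fL f1 f2 v vU.
have [|c ->] := family_spans fam_mem fam_free _ vU; first by rewrite dimU card_lead.
have f0 : f 0 = 0 by have := fL (- 1) 0 0; rewrite scaler0 addr0 mulN1r addNr.
elim/big_rec: _ => // x w0 _ w0E; rewrite fL w0E addr0.
have [i0 ij jn i3] := leadP x.
suff -> : f (fam x) = 0 by rewrite mulr0.
by rewrite /fam; case: eqP => e; [apply: f2 | apply: f1]; lia.
Qed.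

Hypothesis r21 : r ^+ 2 != 1.
Hypothesis r2N1 : r ^+ 2 != -1.
Hypothesis r4N1 : r ^+ 4 != -1.

Lemma p_mul_r3_of_polytabloid : p * r ^+ 3 = 1.
Proof.
have yU : N 1 (polt a b 1) \in U by apply: Uinv; [lia | apply: polt_mem; lia].
have n4 : (4 <= n)%N by lia.
have kL i j : linear_for *%R (kappa (X := X) a b i j).
  by move=> c u v; rewrite /kappa !(coD, coZ); ring.
have K13 : kappa (X := X) a b 1 3 (N 1 (polt a b 1)) = 0.
  apply: (functional_eq0 (kL 1 3) _ _ yU).
    by move=> i j _ _; apply: kappa_polab => //; lia.
  by move=> i _ _; apply: kappa_polt => //; lia.
have K14 : kappa (X := X) a b 1 4 (N 1 (polt a b 1)) = 0.
  apply: (functional_eq0 (kL 1 4) _ _ yU).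
    by move=> i j _ _; apply: kappa_polab => //; lia.
  by move=> i _ _; apply: kappa_polt => //; lia.
have T : theta (X := X) (N 1 (polt a b 1)) = 0.
  apply: (functional_eq0 (@theta_linear _ _ _ _ X) _ _ yU).
    by move=> i j i0 /andP[ij jn]; apply: theta_polab.
  by move=> i; apply: theta_polt.
rewrite kappa14_N1_polt // in K14; rewrite kappa13_N1_polt // in K13.
rewrite theta_N1_polt // in T.
have m0 : m != 0.
  apply: contraNneq r21 => /(congr1 (fun x => r * x)).
  by rewrite mulrBr divff // mulr0 -expr2 => /eqP; rewrite subr_eq0 eq_sym.
have r2 : r ^+ 2 != 0 by rewrite expf_neq0.
move/eqP: K14; rewrite !mulf_eq0 (negbTE m0) /= => /orP[] /eqP ab.
  have bE : b = r ^+ 2 * a.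
    by rewrite -[LHS](divfK r2) mulrC; congr (_ * _); apply/eqP; rewrite -subr_eq0 ab.
  have a0 : a != 0 by apply: contraNneq b0 => a0; rewrite bE a0 mulr0.
  have a2 : a ^+ 2 != 0 by rewrite expf_neq0.
  have : a ^+ 2 * (1 - p * r ^+ 3) = 0 by rewrite -K13 bE; field; rewrite r0.
  by move/eqP; rewrite mulf_eq0 (negbTE a2) /= subr_eq0 => /eqP.
have aE : a = - b by apply/eqP; rewrite -addr_eq0 ab.
have b2 : b ^+ 2 != 0 by rewrite expf_neq0.
have pE : p = r.
  have : b ^+ 2 * (1 - p / r) = 0 by rewrite -K13 aE; field; rewrite r0.
  move/eqP; rewrite mulf_eq0 (negbTE b2) /= subr_eq0 => /eqP pr.
  by rewrite -[p](divfK r0) -pr mul1r.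
(* For a = - b and p = r the equation given by theta contradicts r^4 <> -1 and
   r^2 <> -1. *)
have : b * ((r ^+ 4 + 1) * (r ^+ 2 + 1)) = 0.
  by rewrite -(mulr0 (r ^+ 2)) -T aE pE; field; rewrite r0.
by move/eqP; rewrite !mulf_eq0 (negbTE b0) !addr_eq0 (negbTE r4N1) (negbTE r2N1).
Qed.

End Family.
End PolytabloidModule.

(** * The value of l *)

Section Model_main.
Variables (F : fieldType) (p r : F) (n : nat) (X : cgw_model p r n).
Hypothesis r0 : r != 0.
Local Notation m := (r^-1 - r).
Local Notation N := (cgw_nu X).
Local Notation co := (cgw_co X).

Lemma p_mul_r3 (U : {vspace cgw_space X}) : (6 <= n)%N -> p != 0 ->
  (forall k, (1 <= k <= n)%N -> r ^+ (2 * k) != 1) ->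
  (forall k, (1 <= k <= n - 1)%N -> r ^+ (2 * k) != -1) ->
  (forall k v, (1 <= k <= n)%N -> v \in U -> N k v \in U) ->
  \dim U = ((n * (n - 3)) %/ 2)%N -> p * r ^+ 3 = 1.
Proof.
move=> n6 p0 hr1 hrN1 Uinv dimU.
have r21 : r ^+ 2 != 1 by apply: (hr1 1%N); lia.
have r2N1 : r ^+ 2 != -1 by apply: (hrN1 1%N); lia.
have r4N1 : r ^+ 4 != -1 by apply: (hrN1 2%N); lia.
have val_p a b : b != 0 -> polab X a b 1 3 \in U -> p * r ^+ 3 = 1.
  by move=> b0 vU; apply: (p_mul_r3_of_polytabloid r0 n6 Uinv b0 vU dimU).
apply/eqP; apply: contraT => pr3.
(* The whole space contains a polytabloid. *)
have Uproper : U <> fullv.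
  move=> UE; case/eqP: pr3; apply: (val_p 0 1); first exact: oner_neq0.
  by rewrite UE memvf.
have noA v : v \in U -> N 2 v = - (r^-1 *: v) -> N 4 v = - (r^-1 *: v) -> v = 0.
  move=> vU v2 v4; have vE := polab_shape r0 r2N1 n6 v2 v4.
  have [b0|b0] := eqVneq (co true 1 3 v) 0; last first.
    by case/eqP: pr3; apply: (val_p (co false 1 3 v) (co true 1 3 v)); rewrite -?vE.
  (* When v has no hatted part, nu_1 v has one. *)
  have [a0|a0] := eqVneq (co false 1 3 v) 0.
    by rewrite vE a0 b0 /polab !scale0r addr0.
  case/eqP: pr3; apply: (val_p (- m * co false 1 3 v) (- (r * co false 1 3 v))).
    by rewrite oppr_eq0 mulf_neq0.
  suff <- : N 1 v = polab X (- m * co false 1 3 v) (- (r * co false 1 3 v)) 1 3.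
    by apply: Uinv => //; lia.
  rewrite {1}vE N1_polab //; last lia.
  by rewrite b0 mulr0 oppr0 sub0r /polab mulNr (scaleNr (r * _)).
have q1 : r ^+ (2 * (n - 2)) != 1 by apply: hr1; lia.
have q2 : r ^+ (2 * (n - 4)) != 1 by apply: hr1; lia.
have := dim_le_succ r0 n6 p0 r2N1 q1 q2 Uinv Uproper noA; rewrite dimU leqNgt => /negP; case.
have [k ->] : exists k, n = k + 6 by exists (n - 6)%N; lia.
rewrite leq_divRL //; nia.
Qed.

End Model_main.

Section Instance.
Variables (F : fieldType) (l r : F) (n : nat).
Hypothesis r0 : r != 0.

(** The representation on V_n. *)
Definition V_model : cgw_model l^-1 r n.
Proof.
apply: (@CgwModel F l^-1 r n (V F n) (wvec F n) (nu l r n)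
  (fun h i j => @wcoef F n h i j : {scalar V F n})).
- exact: wcoef_wvec.
- exact: vec_eq.
- exact: vec_ind.
- by move=> k h s t kn -> ->; apply: nuk_root.
- by move=> k h s t ->; apply: nuk_lt.
- by move=> k h s t ->; apply: nuk_gt.
- by move=> k h s t e -> kt tn et; rewrite nuk_l // -et addnK.
- by move=> k h s t e -> sk kn es; rewrite nuk_r // -es addnK.
- exact: nuk_other.
- exact: nu1_w12.
- by move=> j; apply: nu1_w1.
- exact: nu1_w2.
- exact: nu1_w.
- exact: nu1_h12.
- exact: nu1_h1.
- exact: nu1_h2.
- exact: nu1_h34.
Defined.

End Instance.

Theorem theorem6 (R : realType) (n : nat) (l r : R[i]) :
  (6 <= n)%N -> l != 0 -> r != 0 ->
  (forall k : nat, (1 <= k <= n)%N -> r ^+ (2 * k) != 1) ->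
  (forall k : nat, (1 <= k <= n - 1)%N -> r ^+ (2 * k) != -1) ->
  (exists U : {vspace V (Qadj l r) n},
     irreducible_invariant (Qadj_l l r) (Qadj_r l r) U /\
     \dim U = ((n * (n - 3)) %/ 2)%N) ->
  l = r ^+ 3.
Proof.
move=> n6 l0 r0 hr1 hrN1 [U [[Uinv _ _] dimU]].
have valX k : val (Qadj_r l r ^+ k) = r ^+ k by rewrite rmorphXn.
have L0 : Qadj_l l r != 0 by rewrite -(inj_eq val_inj) rmorph0.
have R0 : Qadj_r l r != 0 by rewrite -(inj_eq val_inj) rmorph0.
have : (Qadj_l l r)^-1 * Qadj_r l r ^+ 3 = 1.
  apply: (@p_mul_r3 _ _ _ _ (V_model (Qadj_l l r) n R0) R0 U) => //.
  - by rewrite invr_eq0.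
  - by move=> k kn; rewrite -(inj_eq val_inj) valX rmorph1 hr1.
  - by move=> k kn; rewrite -(inj_eq val_inj) valX rmorphN1 hrN1.
  - by move=> k v kn vU; apply: (subvP (Uinv k kn)); apply: memv_img.
move/(congr1 (fun x => Qadj_l l r * x)); rewrite mulVKf // mulr1 => /(congr1 val).
by rewrite valX.
Qed.
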